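(* Let $1\to G\to H\xrightarrow{j} Q\to 1$ be an extension of finite groups, and let $c$ be the associated $U(1)$-valued $2$-cocycle on the action groupoid $\widehat G\rtimes Q$ (see context). Then the group algebra $\mathbb{C}H$ is Morita equivalent to the twisted groupoid algebra $C(\widehat G\rtimes Q,c)$.
   Context: Identify $G$ with a normal subgroup of $H$. Fix a section $s:Q\to H$ of $j$ (a map with $j\circ s=\mathrm{id}$, $s(1)=1$), and put $\tau(q_1,q_2)=s(q_1)s(q_2)s(q_1q_2)^{-1}\in G$. $\widehat G$ is the finite set of isomorphism classes of irreducible unitary $G$-representations; for each class $[\rho]$ fix a representative $\rho:G\to \mathrm{End}(V_\rho)$. For $q\in Q$, $q([\rho])\in\widehat G$ is the class of $g\mapsto \rho(s(q)gs(q)^{-1})$; this is a right action of $Q$ on $\widehat G$, written on the left, so $(q_1q_2)([\rho])=q_2(q_1([\rho]))$. The chosen representative of the class $q([\rho])$ is denoted $q([\rho]):G\to\mathrm{End}(V_{q([\rho])})$. Choose unitary isomorphisms $T_q^{[\rho]}:V_\rho\to V_{q([\rho])}$ with $\rho(s(q)gs(q)^{-1})=(T_q^{[\rho]})^{-1}\circ q([\rho])(g)\circ T_q^{[\rho]}$ for all $g\in G$, and $T_1^{[\rho]}=\mathrm{id}$. By Schur's lemma there are unique scalars $c^{[\rho]}(q_1,q_2)\in U(1)$ with $T_{q_2}^{q_1([\rho])}\circ T_{q_1}^{[\rho]}=c^{[\rho]}(q_1,q_2)\,T_{q_1q_2}^{[\rho]}\circ\rho(\tau(q_1,q_2))^{-1}$.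 The algebra $C(\widehat G\rtimes Q,c)$ has $\mathbb{C}$-basis $\{([\rho],q):[\rho]\in\widehat G,\ q\in Q\}$ and product $([\rho],q)\circ([\rho'],q')=c^{[\rho]}(q,q')([\rho],qq')$ if $[\rho']=q([\rho])$, and $0$ otherwise. Two unital algebras $A,B$ are Morita equivalent if there are an $A$-$B$ bimodule $P$ and a $B$-$A$ bimodule $P'$ with $P\otimes_BP'\cong A$ as $A$-$A$ bimodules and $P'\otimes_AP\cong B$ as $B$-$B$ bimodules. *)

(* Defs.v *)
From HB Require Import structures.
From mathcomp Require Import all_boot all_order all_fingroup all_algebra.
From mathcomp Require Import spectral mxrepresentation.
From mathcomp Require Import boolp reals complex.
From mathcomp.multinomials Require Import freeg.

Set Implicit Arguments.
Unset Strict Implicit.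
Unset Printing Implicit Defensive.

Import Order.TTheory GRing.Theory Num.Theory.
Local Open Scope ring_scope.
Local Open Scope sesquilinear_scope.

Section Bimodule.
Variable F : fieldType.

(* As usual for modules over F-algebras, the two F-actions on a bimodule
   induced by A and by B coincide: both actions are F-bilinear for one and the
   same F-vector space structure. *)
Record bimodule (A B : algType F) := Bimodule {
  bimod_sort :> lmodType F;
  lact : A -> bimod_sort -> bimod_sort;
  ract : bimod_sort -> B -> bimod_sort;
  lact_linearl : forall p, linear (lact^~ p);
  lact_linearr : forall a, linear (lact a);
  lact1 : forall p, lact 1 p = p;
  lactA : forall a a' p, lact (a * a') p = lact a (lact a' p);
  ract_linearl : forall b, linear (ract^~ b);
  ract_linearr : forall p, linear (ract p);
  ract1 : forall p, ract p 1 = p;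
  ractA : forall p b b', ract p (b * b') = ract (ract p b) b';
  lractA : forall a p b, ract (lact a p) b = lact a (ract p b) }.

Section IsLinear.
Variables (U V : lmodType F) (f : U -> V).
Hypothesis fL : linear f.

Lemma is_linear0 : f 0 = 0.
Proof. by have := fL (-1) 0 0; rewrite !scaleN1r !addNr. Qed.

Lemma is_linearZ c x : f (c *: x) = c *: f x.
Proof. by have := fL c x 0; rewrite !addr0 is_linear0 addr0. Qed.

Lemma is_linearD x y : f (x + y) = f x + f y.
Proof. by have := fL 1 x y; rewrite !scale1r. Qed.

End IsLinear.

Definition bimodule_iso (A B : algType F) (M N : bimodule A B) : Prop :=
  exists f : {linear M -> N}, [/\ bijective f,
    forall a m, f (lact a m) = lact a (f m) &
    forall m b, f (ract m b) = ract (f m) b].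

Section Regular.
Variable A : algType F.

Fact mul_linearl (p : A) : linear ( *%R^~ p : A -> A).
Proof. by move=> c a b; rewrite /= mulrDl scalerAl. Qed.

Fact mul_linearr (a : A) : linear ( *%R a).
Proof. by move=> c p q; rewrite mulrDr scalerAr. Qed.

Definition regular_bimodule : bimodule A A :=
  @Bimodule A A A *%R *%R mul_linearl mul_linearr (@mul1r A)
    (fun a b c => esym (mulrA a b c)) mul_linearl mul_linearr
    (@mulr1 A) (@mulrA A) (fun a b c => esym (mulrA a b c)).

End Regular.

(* P (x)_B P' is the free F-vector space on P * P' modulo the span of the
   usual relators. *)
Section Tensor.
Variables (A B D : algType F) (P : bimodule A B) (P' : bimodule B D).

Local Notation free := {freeg (P * P')%type / F}.
Definition free_gen (x : P * P') : free := Freeg [:: (1, x)].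

Inductive tensor_relator : free -> Prop :=
| TensorAddl p1 p2 p' : tensor_relator
    (free_gen (p1 + p2, p') - free_gen (p1, p') - free_gen (p2, p'))
| TensorAddr p p1' p2' : tensor_relator
    (free_gen (p, p1' + p2') - free_gen (p, p1') - free_gen (p, p2'))
| TensorScale c p p' : tensor_relator
    (free_gen (c *: p, p') - c *: free_gen (p, p'))
| TensorBalanced p b p' : tensor_relator
    (free_gen (ract p b, p') - free_gen (p, lact b p')).

Definition tensor_null_spec (x : free) : Prop :=
  exists2 s : seq (F * free), (forall y, y \in s -> tensor_relator y.2)
    & x = \sum_(y <- s) y.1 *: y.2.

Definition tensor_null : pred free := fun x => `[<tensor_null_spec x>].

Lemma tensor_null_relator x : tensor_relator x -> tensor_null x.
Proof.
move=> rx; apply/asboolP; exists [:: (1, x)]; last by rewrite big_seq1 scale1r.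
by move=> y; rewrite inE => /eqP->.
Qed.

Lemma tensor_null_linear c x y :
  tensor_null x -> tensor_null y -> tensor_null (c *: x + y).
Proof.
move=> /asboolP[s sP ->] /asboolP[t tP ->]; apply/asboolP.
exists ([seq (c * u.1, u.2) | u <- s] ++ t).
  move=> u; rewrite mem_cat => /orP[/mapP[v /sP + ->//]|/tP//].
rewrite big_cat big_map scaler_sumr /=; congr (_ + _).
by apply: eq_bigr => u _; rewrite scalerA.
Qed.

Lemma tensor_null0 : tensor_null 0.
Proof. by apply/asboolP; exists [::]; rewrite ?big_nil. Qed.

Fact tensor_null_zmod : zmod_closed tensor_null.
Proof.
split=> [|x y xN yN]; first exact: tensor_null0.
rewrite unfold_in addrC -scaleN1r; exact: tensor_null_linear.
Qed.

HB.instance Definition _ := GRing.isZmodClosed.Build free tensor_null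
  tensor_null_zmod.

Definition tensor_ker : zmodClosed free :=
  GRing.ZmodClosed.clone free tensor_null _.
Definition tensor_space : Type := Quotient.quot tensor_ker.
HB.instance Definition _ := GRing.Zmodule.on tensor_space.

Definition tensor_pi (x : free) : tensor_space :=
  \pi_(Quotient.quot tensor_ker)%qT x.
Definition tensor_repr (t : tensor_space)  : free := generic_quotient.repr t.

Lemma tensor_reprK t : tensor_pi (tensor_repr t) = t.
Proof. exact: reprK. Qed.

Lemma tensor_piP x y : tensor_pi x = tensor_pi y <-> tensor_null (x - y).
Proof.
have -> : tensor_null (x - y) = (x - y \in tensor_ker) by [].
by rewrite Quotient.idealrBE; split=> [exy|/eqP//]; apply/eqP.
Qed.

Lemma tensor_piD x y : tensor_pi (x + y) = tensor_pi x + tensor_pi y.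
Proof. by rewrite /tensor_pi raddfD. Qed.


Definition tensor_scale c (t : tensor_space) : tensor_space :=
  tensor_pi (c *: tensor_repr t).

Lemma tensor_scale_pi c x : tensor_scale c (tensor_pi x) = tensor_pi (c *: x).
Proof.
apply/tensor_piP; rewrite -scalerBr -[_ *: _]addr0.
apply: tensor_null_linear tensor_null0.
by apply/tensor_piP; rewrite tensor_reprK.
Qed.

Fact tensor_scaleA c d t :
  tensor_scale c (tensor_scale d t) = tensor_scale (c * d) t.
Proof. by rewrite -(tensor_reprK t) !tensor_scale_pi scalerA. Qed.

Fact tensor_scale1 : left_id 1 tensor_scale.
Proof. by move=> t; rewrite -(tensor_reprK t) tensor_scale_pi scale1r. Qed.

Fact tensor_scaleDr : right_distributive tensor_scale +%R.
Proof.
move=> c t u; rewrite -(tensor_reprK t) -(tensor_reprK u).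
by rewrite -tensor_piD !tensor_scale_pi scalerDr tensor_piD.
Qed.

Fact tensor_scaleDl t : {morph tensor_scale^~ t : c d / c + d}.
Proof.
move=> c d /=; rewrite -(tensor_reprK t).
by rewrite !tensor_scale_pi scalerDl tensor_piD.
Qed.

HB.instance Definition _ := GRing.Zmodule_isLmodule.Build F tensor_space
  tensor_scaleA tensor_scale1 tensor_scaleDr tensor_scaleDl.

Fact tensor_pi_linear : linear tensor_pi.
Proof.
by move=> c x y; rewrite tensor_piD -tensor_scale_pi.
Qed.
HB.instance Definition _ :=
  GRing.isLinear.Build F free tensor_space *:%R tensor_pi tensor_pi_linear.

Definition tensor p p' : tensor_space := tensor_pi (free_gen (p, p')).

Lemma tensor_relator0 x : tensor_relator x -> tensor_pi x = 0.
Proof.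
move=> rx; rewrite -(linear0 tensor_pi); apply/tensor_piP.
by rewrite subr0; apply: tensor_null_relator.
Qed.

Lemma tensorDl p1 p2 p' : tensor (p1 + p2) p' = tensor p1 p' + tensor p2 p'.
Proof.
apply/eqP; rewrite -subr_eq0 opprD addrA -!linearB; apply/eqP.
exact/tensor_relator0/TensorAddl.
Qed.

Lemma tensorDr p p1' p2' : tensor p (p1' + p2') = tensor p p1' + tensor p p2'.
Proof.
apply/eqP; rewrite -subr_eq0 opprD addrA -!linearB; apply/eqP.
exact/tensor_relator0/TensorAddr.
Qed.

Lemma tensorZl c p p' : tensor (c *: p) p' = c *: tensor p p'.
Proof.
apply/eqP; rewrite -subr_eq0 -linearZ -linearB; apply/eqP.
exact/tensor_relator0/TensorScale.
Qed.

Lemma tensor_balanced p b p' : tensor (ract p b) p' = tensor p (lact b p').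
Proof.
apply/eqP; rewrite -subr_eq0 -linearB; apply/eqP.
exact/tensor_relator0/TensorBalanced.
Qed.

Lemma tensorZr c p p' : tensor p (c *: p') = c *: tensor p p'.
Proof.
rewrite -tensorZl -[p in RHS]ract1 -(is_linearZ (ract_linearr p)).
by rewrite tensor_balanced (is_linearZ (lact_linearl p')) lact1.
Qed.

Section Lift.
Variables (U : lmodType F) (f : P -> P' -> U).

Definition free_lift : free -> U := fglift (fun u => f u.1 u.2).

Lemma free_lift_gen p p' : free_lift (free_gen (p, p')) = f p p'.
Proof. by rewrite /free_lift liftU scale1r. Qed.

Fact free_lift_linear : linear free_lift.
Proof.
have liftB x y : free_lift (x - y) = free_lift x - free_lift y.
  exact: lift_is_additive.
have lift0 : free_lift 0 = 0 by rewrite -(subrr 0) liftB subrr.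
have liftN x : free_lift (- x) = - free_lift x.
  by rewrite -sub0r liftB lift0 sub0r.
have liftD x y : free_lift (x + y) = free_lift x + free_lift y.
  by rewrite -[y in LHS]opprK liftB liftN opprK.
move=> c x y; rewrite liftD; congr (_ + _).
rewrite -(freeg_sumE x) scaler_sumr !(big_morph free_lift liftD lift0).
rewrite scaler_sumr; apply: eq_bigr => u _; set k := coeff u x.
have -> : c *: Freeg [:: (k, u)] = Freeg [:: (c * k, u)] :> free.
  by apply/eqP/freeg_eqP => v; rewrite coeffZ !coeffU mulrA.
by rewrite /free_lift !liftU scalerA.
Qed.

HB.instance Definition _ :=
  GRing.isLinear.Build F free U *:%R free_lift free_lift_linear.

Definition tensor_lift (t : tensor_space) : U := free_lift (tensor_repr t).

Hypotheses (f_linearl : forall p', linear (f^~ p'))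
           (f_linearr : forall p, linear (f p))
           (f_balanced : forall p b p', f (ract p b) p' = f p (lact b p')).

Lemma tensor_lift_pi x : tensor_lift (tensor_pi x) = free_lift x.
Proof.
apply/eqP; rewrite -subr_eq0 -linearB; apply/eqP.
have : tensor_null (tensor_repr (tensor_pi x) - x).
  by apply/tensor_piP; rewrite tensor_reprK.
case/asboolP=> s sP ->; rewrite linear_sum big_seq big1 // => y /sP.
move: y.2 => z rz; rewrite linearZ /= (_ : free_lift z = 0) ?scaler0 //.
case: rz => [p1 p2 p'|p p1' p2'|c p p'|p b p'];
  rewrite !(linearB, linearZ) /= !free_lift_gen.
- by rewrite (is_linearD (f_linearl p')) /= -addrA -opprD subrr.
- by rewrite (is_linearD (f_linearr p)) -addrA -opprD subrr.
- by rewrite (is_linearZ (f_linearl p')) scalerN subrr.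
- by rewrite f_balanced subrr.
Qed.

Lemma tensor_liftE p p' : tensor_lift (tensor p p') = f p p'.
Proof. by rewrite tensor_lift_pi free_lift_gen. Qed.

Lemma tensor_lift_linear : linear tensor_lift.
Proof.
move=> c t u; rewrite -(tensor_reprK t) -(tensor_reprK u) -linearP.
by rewrite !tensor_lift_pi linearP.
Qed.

End Lift.

Lemma tensor_linear_ext (U : lmodType F) (f g : tensor_space -> U) :
    linear f -> linear g ->
  (forall p p', f (tensor p p') = g (tensor p p')) -> f =1 g.
Proof.
move=> fL gL fg t; rewrite -(tensor_reprK t) -(freeg_sumE (tensor_repr t)).
rewrite linear_sum !(big_morph _ (is_linearD fL) (is_linear0 fL)).
rewrite (big_morph _ (is_linearD gL) (is_linear0 gL)).
apply: eq_bigr => -[p p'] _.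
set k := coeff _ _.
have -> : Freeg [:: (k, (p, p'))] = k *: free_gen (p, p').
  by apply/eqP/freeg_eqP => v; rewrite coeffZ !coeffU mul1r.
by rewrite linearZ (is_linearZ fL) (is_linearZ gL) fg.
Qed.

Definition tensor_lact (a : A) : tensor_space -> tensor_space :=
  tensor_lift (fun p p' => tensor (lact a p) p').

Definition tensor_ract (t : tensor_space) (d : D) : tensor_space :=
  tensor_lift (fun p p' => tensor p (ract p' d)) t.

Fact tensor_linearl p' : linear (tensor^~ p').
Proof. by move=> c p q; rewrite /= tensorDl tensorZl. Qed.

Fact tensor_linearr p : linear (tensor p).
Proof. by move=> c p' q'; rewrite tensorDr tensorZr. Qed.

Lemma tensor_lactE a p p' : tensor_lact a (tensor p p') = tensor (lact a p) p'.
Proof.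
rewrite /tensor_lact tensor_liftE // => [q' c p1 p2|q|q b q'].
- by rewrite /= lact_linearr tensor_linearl.
- exact: tensor_linearr.
- by rewrite -lractA tensor_balanced.
Qed.

Lemma tensor_lact_linearr a : linear (tensor_lact a).
Proof.
apply: tensor_lift_linear => [q' c p1 p2|q|q b q'].
- by rewrite /= lact_linearr tensor_linearl.
- exact: tensor_linearr.
- by rewrite -lractA tensor_balanced.
Qed.

Lemma tensor_ractE p p' d : tensor_ract (tensor p p') d = tensor p (ract p' d).
Proof.
rewrite /tensor_ract tensor_liftE // => [q'|q c p1 p2|q b q'].
- exact: tensor_linearl.
- by rewrite /= ract_linearl tensor_linearr.
- by rewrite tensor_balanced lractA.
Qed.

Lemma tensor_ract_linearl d : linear (tensor_ract^~ d).
Proof.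
apply: tensor_lift_linear => [q'|q c p1 p2|q b q'].
- exact: tensor_linearl.
- by rewrite /= ract_linearl tensor_linearr.
- by rewrite tensor_balanced lractA.
Qed.


Lemma tensor_lact_linearl t : linear (tensor_lact^~ t).
Proof.
move=> c a a'; move: t; apply: tensor_linear_ext.
- exact: tensor_lact_linearr.
- move=> d t u; rewrite !tensor_lact_linearr !scalerDr !scalerA (mulrC c).
  by rewrite addrACA.
- by move=> p p'; rewrite !tensor_lactE /= lact_linearl tensor_linearl.
Qed.

Lemma tensor_ract_linearr t : linear (tensor_ract t).
Proof.
move=> c b b'; move: t; apply: tensor_linear_ext.
- exact: tensor_ract_linearl.
- move=> d t u; rewrite !(tensor_ract_linearl _ d) !scalerDr !scalerA (mulrC c).
  by rewrite addrACA.
- by move=> p p'; rewrite !tensor_ractE ract_linearr tensor_linearr.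
Qed.

Fact id_linear : linear (id : tensor_space -> tensor_space).
Proof. by []. Qed.

Lemma tensor_lact1 t : tensor_lact 1 t = t.
Proof.
move: t; apply: tensor_linear_ext id_linear _; first exact: tensor_lact_linearr.
by move=> p p'; rewrite tensor_lactE lact1.
Qed.

Lemma tensor_ract1 t : tensor_ract t 1 = t.
Proof.
move: t; apply: tensor_linear_ext id_linear _; first exact: tensor_ract_linearl.
by move=> p p'; rewrite tensor_ractE ract1.
Qed.

Lemma tensor_lactA a a' t :
  tensor_lact (a * a') t = tensor_lact a (tensor_lact a' t).
Proof.
move: t; apply: tensor_linear_ext; first exact: tensor_lact_linearr.
  by move=> c t u; rewrite !tensor_lact_linearr.
by move=> p p'; rewrite !tensor_lactE lactA.
Qed.

Lemma tensor_ractA t b b' :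
  tensor_ract t (b * b') = tensor_ract (tensor_ract t b) b'.
Proof.
move: t; apply: tensor_linear_ext; first exact: tensor_ract_linearl.
  by move=> c t u; rewrite !tensor_ract_linearl.
by move=> p p'; rewrite !tensor_ractE ractA.
Qed.

Lemma tensor_lractA a t b :
  tensor_ract (tensor_lact a t) b = tensor_lact a (tensor_ract t b).
Proof.
move: t; apply: tensor_linear_ext.
- by move=> c t u; rewrite tensor_lact_linearr !tensor_ract_linearl.
- by move=> c t u; rewrite tensor_ract_linearl !tensor_lact_linearr.
- by move=> p p'; rewrite tensor_lactE !tensor_ractE tensor_lactE.
Qed.

Definition tensor_bimodule : bimodule A D :=
  @Bimodule A D tensor_space tensor_lact tensor_ract
    tensor_lact_linearl tensor_lact_linearr tensor_lact1 tensor_lactA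
    tensor_ract_linearl tensor_ract_linearr tensor_ract1 tensor_ractA
    tensor_lractA.

End Tensor.

Definition morita_equivalent (A B : algType F) : Prop :=
  exists (P : bimodule A B) (P' : bimodule B A),
    bimodule_iso (tensor_bimodule P P') (regular_bimodule A) /\
    bimodule_iso (tensor_bimodule P' P) (regular_bimodule B).

End Bimodule.

(* The bilinear extension to F^X of a product m : X -> X -> F^X of basis
   vectors. *)
Section BilinearExtension.
Variables (F : fieldType) (X : finType) (m : X -> X -> {ffun X -> F^o}).
Local Notation V := {ffun X -> F^o}.

Definition basis_vec (x : X) : V := [ffun y => (y == x)%:R].

Definition bilin_ext (f g : V) : V := \sum_x \sum_y (f x * g y) *: m x y.

Lemma basis_vec_sum (f : V) : f = \sum_x f x *: basis_vec x.
Proof.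
apply/ffunP=> y; rewrite sum_ffunE (bigD1 y) //= big1 ?addr0.
  by rewrite !ffunE eqxx [_ *: _]mulr1.
by move=> x /negPf xy; rewrite !ffunE eq_sym xy [_ *: _]mulr0.
Qed.

Lemma bilin_ext_linearl g : linear (bilin_ext^~ g).
Proof.
move=> c f f'; rewrite /= /bilin_ext scaler_sumr -big_split /=.
apply: eq_bigr => x _; rewrite scaler_sumr -big_split /=; apply: eq_bigr => y _.
by rewrite !ffunE mulrDl scalerDl scalerA mulrA.
Qed.

Lemma bilin_ext_linearr f : linear (bilin_ext f).
Proof.
move=> c g g'; rewrite /bilin_ext scaler_sumr -big_split /=.
apply: eq_bigr => x _; rewrite scaler_sumr -big_split /=; apply: eq_bigr => y _.
by rewrite !ffunE mulrDr scalerDl scalerA mulrCA.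
Qed.

Lemma bilin_ext_basis x y : bilin_ext (basis_vec x) (basis_vec y) = m x y.
Proof.
rewrite /bilin_ext (bigD1 x) //= (bigD1 y) //= !ffunE !eqxx mulr1 scale1r.
rewrite !big1 ?addr0 // => [z /negPf zx|z /negPf zy].
  by rewrite big1 // => w _; rewrite !ffunE zx mul0r scale0r.
by rewrite !ffunE zy mulr0 scale0r.
Qed.

Lemma linear_basis_ext (U : lmodType F) (f g : V -> U) : linear f -> linear g ->
  (forall x, f (basis_vec x) = g (basis_vec x)) -> f =1 g.
Proof.
move=> fL gL fg v; rewrite (basis_vec_sum v).
rewrite (big_morph _ (is_linearD fL) (is_linear0 fL)).
rewrite (big_morph _ (is_linearD gL) (is_linear0 gL)).
by apply: eq_bigr => x _; rewrite (is_linearZ fL) (is_linearZ gL) fg.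
Qed.

Lemma bilin_extA :
    (forall x y z, bilin_ext (basis_vec x) (m y z) =
                   bilin_ext (m x y) (basis_vec z)) ->
  associative bilin_ext.
Proof.
move=> mA f g h.
move: f; apply: linear_basis_ext => [||x]; first exact: bilin_ext_linearl.
  by move=> c f f'; rewrite !bilin_ext_linearl.
move: g; apply: linear_basis_ext => [||y].
- by move=> c f f'; rewrite bilin_ext_linearl bilin_ext_linearr.
- by move=> c f f'; rewrite bilin_ext_linearr bilin_ext_linearl.
move: h; apply: linear_basis_ext => [||z].
- by move=> c f f'; rewrite !bilin_ext_linearr.
- by move=> c f f'; rewrite !bilin_ext_linearr.
by rewrite !bilin_ext_basis mA.
Qed.

Lemma bilin_ext1l (e : V) :
  (forall x, bilin_ext e (basis_vec x) = basis_vec x) -> left_id e bilin_ext.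
Proof.
move=> e1; apply: (@linear_basis_ext _ _ id) => //; exact: bilin_ext_linearr.
Qed.

Lemma bilin_ext1r (e : V) :
  (forall x, bilin_ext (basis_vec x) e = basis_vec x) -> right_id e bilin_ext.
Proof.
move=> e1; apply: (@linear_basis_ext _ _ id) => //; exact: bilin_ext_linearl.
Qed.

Lemma bilin_extDl : left_distributive bilin_ext +%R.
Proof. by move=> f g h; rewrite (is_linearD (bilin_ext_linearl h)). Qed.

Lemma bilin_extDr : right_distributive bilin_ext +%R.
Proof. by move=> f g h; rewrite (is_linearD (bilin_ext_linearr f)). Qed.

End BilinearExtension.

Section GroupAlgebra.
Variables (F : fieldType) (gT : finGroupType).

(* A copy of {ffun gT -> F^o}, whose own ring structure is pointwise. *)
Definition group_algebra : Type := {ffun gT -> F^o}.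
HB.instance Definition _ := GRing.Lmodule.copy group_algebra {ffun gT -> F^o}.

Definition ga_basis_mul (x y : gT) : {ffun gT -> F^o} := basis_vec F (x * y)%g.
Definition ga_mul : group_algebra -> group_algebra -> group_algebra :=
  bilin_ext ga_basis_mul.
Definition ga_one : group_algebra := basis_vec F 1%g.

Fact ga_mulA : associative ga_mul.
Proof.
by apply: bilin_extA => x y z; rewrite !bilin_ext_basis /ga_basis_mul mulgA.
Qed.

Fact ga_mul1 : left_id ga_one ga_mul.
Proof.
apply: bilin_ext1l => x.
by rewrite bilin_ext_basis /ga_basis_mul mul1g.
Qed.

Fact ga_mulr1 : right_id ga_one ga_mul.
Proof.
apply: bilin_ext1r => x.
by rewrite bilin_ext_basis /ga_basis_mul mulg1.
Qed.

Fact ga_one_neq0 : ga_one != 0.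
Proof.
by apply/eqP=> /ffunP/(_ 1%g)/eqP; rewrite !ffunE eqxx oner_eq0.
Qed.

HB.instance Definition _ := GRing.Zmodule_isNzRing.Build group_algebra
  ga_mulA ga_mul1 ga_mulr1 (@bilin_extDl _ _ _) (@bilin_extDr _ _ _)
  ga_one_neq0.

Fact ga_scaleAl c (f g : group_algebra) : c *: (f * g) = (c *: f) * g.
Proof. exact: esym (is_linearZ (bilin_ext_linearl _ g) c f). Qed.

HB.instance Definition _ :=
  GRing.Lmodule_isLalgebra.Build F group_algebra ga_scaleAl.

Fact ga_scaleAr c (f g : group_algebra) : c *: (f * g) = f * (c *: g).
Proof. exact: esym (is_linearZ (bilin_ext_linearr _ f) c g). Qed.

HB.instance Definition _ :=
  GRing.Lalgebra_isAlgebra.Build F group_algebra ga_scaleAr.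

End GroupAlgebra.

Record extension (gT hT qT : finGroupType) := Extension {
  ext_inj : {morphism [set: gT] >-> hT};
  ext_proj : {morphism [set: hT] >-> qT};
  ext_injP : ('injm ext_inj)%g;
  ext_exact : (ext_inj @* [set: gT] = 'ker ext_proj)%g;
  ext_projP : (ext_proj @* [set: hT] = [set: qT])%g }.

Section Extension.
Variables (gT hT qT : finGroupType) (E : extension gT hT qT).

Definition ext_sub : {group hT} := (ext_inj E @* [set: gT])%G.

Record ext_section := ExtSection {
  sec :> qT -> hT;
  secK : forall q, ext_proj E (sec q) = q;
  sec1 : sec 1%g = 1%g }.

Lemma mem_ext_sub h : (h \in ext_sub) = (ext_proj E h == 1%g).
Proof.
rewrite /= ext_exact; apply/idP/eqP=> [/mker//|h1].
by apply/kerP; rewrite ?inE.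
Qed.

Lemma ext_projM h h' : ext_proj E (h * h')%g = (ext_proj E h * ext_proj E h')%g.
Proof. by rewrite morphM ?inE. Qed.

Lemma ext_projV h : ext_proj E h^-1%g = (ext_proj E h)^-1%g.
Proof. by rewrite morphV ?inE. Qed.

Lemma ext_sub_conj h g : g \in ext_sub -> (h * g * h^-1)%g \in ext_sub.
Proof.
rewrite !mem_ext_sub !ext_projM ext_projV => /eqP->.
by rewrite mulg1 mulgV.
Qed.

Lemma ext_sub_conjV h g : g \in ext_sub -> (h^-1 * g * h)%g \in ext_sub.
Proof. by move=> gG; rewrite -{2}(invgK h) ext_sub_conj. Qed.

Definition tau (s : ext_section) (q1 q2 : qT) : hT :=
  (s q1 * s q2 * (s (q1 * q2))^-1)%g.

Lemma tau_in s q1 q2 : tau s q1 q2 \in ext_sub.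
Proof. by rewrite mem_ext_sub !ext_projM ext_projV !secK mulgV. Qed.

End Extension.

(* The finite set of isomorphism classes of irreducible unitary representations
   of G, each with a chosen representative: [dual_idx] indexes the classes.
   V_rho is C^n with its standard Hermitian product; matrices act on columns,
   so that composition of linear maps is [*m]. (Irreducibility is the same for
   the row submodules used by [mx_irreducible].) *)
Record unitary_dual (C : numClosedFieldType) (hT : finGroupType)
    (G : {group hT}) := UnitaryDual {
  dual_idx :> finType;
  rep_dim : dual_idx -> nat;
  rep : forall x, mx_representation C G (rep_dim x);
  rep_irr : forall x, mx_irreducible (rep x);
  rep_unitary : forall x g, g \in G -> rep x g \is unitarymx;
  rep_inj : forall x y, mx_rsim (rep x) (rep y) -> x = y;
  rep_full : forall n (rho : mx_representation C G n), mx_irreducible rho ->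
    (forall g, g \in G -> rho g \is unitarymx) ->
    exists x, mx_rsim rho (rep x) }.

Lemma Schur_scalar (C : numClosedFieldType) (gT : finGroupType) (G : {group gT})
    n (rG : mx_representation C G n) (A : 'M_n) :
  mx_irreducible rG -> (forall g, g \in G -> A *m rG g = rG g *m A) ->
  exists a, A = a%:M.
Proof.
move=> irrG cA; have [n_gt0 _] := iffLR (mx_irrP _) irrG.
have [a ea] : exists a, eigenvalue A a.
  case: n n_gt0 A {rG irrG cA} => // n _ A.
  have /closed_rootP[a ra] : size (char_poly A) != 1 by rewrite size_char_poly.
  by exists a; rewrite eigenvalue_root_char.
exists a; apply/eqP; rewrite -subr_eq0; apply/negPn/negP=> nz.
have : A - a%:M \in unitmx.
  apply: (mx_Schur irrG) nz; apply/centgmxP=> g gG.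
  by rewrite mulmxBl mulmxBr cA // scalar_mxC.
case/eigenvalueP: ea => v vA vn0 uA; case/negP: vn0.
rewrite -(mulmxK uA v) mulmxBr vA.
by rewrite -[v *m a%:M]/(mulmx v a%:M) mul_mx_scalar subrr mul0mx.
Qed.

Section Conjugation.
Variables (C : numClosedFieldType) (gT hT qT : finGroupType).
Variables (E : extension gT hT qT) (s : ext_section E).
Local Notation G := (ext_sub E).

Definition conj_mx n (rho : mx_representation C G n) (q : qT) (g : hT) : 'M_n :=
  rho (s q * g * (s q)^-1)%g.

Fact conj_mx_repr n (rho : mx_representation C G n) q :
  mx_repr G (conj_mx rho q).
Proof.
split=> [|g h gG hG]; rewrite /conj_mx.
  by rewrite mulg1 mulgV repr_mx1.
rewrite -repr_mxM ?ext_sub_conj //; congr (rho _).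
by rewrite !mulgA mulgKV.
Qed.

Definition conj_rep n (rho : mx_representation C G n) q :
  mx_representation C G n :=
  MxRepresentation (conj_mx_repr rho q).

Lemma conj_rep_irr n (rho : mx_representation C G n) q :
  mx_irreducible rho -> mx_irreducible (conj_rep rho q).
Proof.
move=> /mx_irrP[n_gt0 irr]; apply/mx_irrP; split=> // U modU; apply: irr.
apply/mxmoduleP=> g gG.
have gG' := ext_sub_conjV (s q) gG; have := mxmoduleP modU _ gG'.
by rewrite /= /conj_mx !mulgA mulgV mul1g mulgK.
Qed.

Lemma conj_rep_rsim n m (rho : mx_representation C G n)
    (sigma : mx_representation C G m) q :
  mx_rsim rho sigma -> mx_rsim (conj_rep rho q) (conj_rep sigma q).
Proof.
case=> B nm freeB homB; exists B => // g gG.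
exact/homB/ext_sub_conj.
Qed.

Lemma conj_repM n (rho : mx_representation C G n) q1 q2 :
  mx_rsim (conj_rep (conj_rep rho q1) q2) (conj_rep rho (q1 * q2)).
Proof.
exists (rho (tau s q1 q2)) => //.
  by rewrite row_free_unit repr_mx_unit ?tau_in.
move=> g gG; rewrite /= /conj_mx -!repr_mxM ?ext_sub_conj ?tau_in //.
by congr (rho _); rewrite /tau !mulgA !mulgKV.
Qed.

Variable X : unitary_dual C G.

Fact dual_act_exists (x : X) q :
  exists y : X, mx_rsim (conj_rep (rep x) q) (rep y).
Proof.
apply: rep_full; first exact/conj_rep_irr/rep_irr.
by move=> g gG; apply/rep_unitary/ext_sub_conj.
Qed.

Definition dual_act_fun (x : X) (q : qT) : X :=
  projT1 (cid (dual_act_exists x q)).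

Lemma dual_act_rsim x q : mx_rsim (conj_rep (rep x) q) (rep (dual_act_fun x q)).
Proof. exact: projT2 (cid (dual_act_exists x q)). Qed.

Fact dual_act1 x : dual_act_fun x 1%g = x.
Proof.
apply/rep_inj/(mx_rsim_trans (mx_rsim_sym (dual_act_rsim x 1%g))).
exists 1%:M; rewrite ?row_free_unit ?unitmx1 // => g gG.
by rewrite /= /conj_mx sec1 mul1g invg1 mulg1 mulmx1 mul1mx.
Qed.

Fact dual_actM x : act_morph dual_act_fun x.
Proof.
move=> q1 q2; apply: rep_inj.
apply: mx_rsim_trans (mx_rsim_sym (dual_act_rsim _ _)) _.
apply: mx_rsim_trans (mx_rsim_sym (conj_repM _ _ _)) _.
apply: mx_rsim_trans (conj_rep_rsim _ (dual_act_rsim _ _)) _.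
exact: dual_act_rsim.
Qed.

(* [dual_act x q] is the class q([rho]) for x = [rho]. *)
Definition dual_act : {action qT &-> X} := TotalAction dual_act1 dual_actM.

(* The representatives of equal classes coincide, but their dimensions are only
   propositionally equal. *)
Definition idx_cast (y y' : X) n (e : y = y') (M : 'M[C]_(rep_dim y, n)) :
  'M[C]_(rep_dim y', n) := castmx (congr1 (@rep_dim _ _ _ X) e, erefl n) M.

(* For a unitary T, the inverse of T is T^t*. *)
Record intertwiners := Intertwiners {
  itw :> forall (x : X) (q : qT), 'M[C]_(rep_dim (dual_act x q), rep_dim x);
  itw_unitary : forall x q, itw x q \is unitarymx;
  itw_unitaryV : forall x q, (itw x q)^t* \is unitarymx;
  itw_conj : forall x q g, g \in G ->
    rep x (s q * g * (s q)^-1)%g =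
      (itw x q)^t* *m rep (dual_act x q) g *m itw x q;
  itw1 : forall x, itw x 1%g = idx_cast (esym (act1 dual_act x)) 1%:M }.

Variable T : intertwiners.

Definition itw_to x q y (e : dual_act x q = y) : 'M[C]_(rep_dim y, rep_dim x) :=
  idx_cast e (T x q).

Lemma itw_to_unitary x q y (e : dual_act x q = y) : itw_to e \is unitarymx.
Proof. by case: _ / e; rewrite /itw_to /idx_cast castmx_id itw_unitary. Qed.

Lemma itw_to_unitaryV x q y (e : dual_act x q = y) :
  (itw_to e)^t* \is unitarymx.
Proof. by case: _ / e; rewrite /itw_to /idx_cast castmx_id itw_unitaryV. Qed.

Lemma itw_toVK x q y (e : dual_act x q = y) : (itw_to e)^t* *m itw_to e = 1%:M.
Proof. by have /unitarymxP := itw_to_unitaryV e; rewrite trmxCK. Qed.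

Lemma itw_toK x q y (e : dual_act x q = y) : itw_to e *m (itw_to e)^t* = 1%:M.
Proof. exact/unitarymxP/itw_to_unitary. Qed.

Lemma itw_to_conj x q y (e : dual_act x q = y) g : g \in G ->
  rep y g *m itw_to e = itw_to e *m rep x (s q * g * (s q)^-1)%g.
Proof.
move=> gG; rewrite (itw_conj T) //.
have : itw_to e *m ((itw_to e)^t* *m rep y g *m itw_to e) = rep y g *m itw_to e.
  by rewrite !mulmxA itw_toK mul1mx.
by case: _ / e; rewrite /itw_to /idx_cast castmx_id => ->.
Qed.

Lemma itw_to_conjV x q y (e : dual_act x q = y) g : g \in G ->
  (itw_to e)^t* *m rep y g = rep x (s q * g * (s q)^-1)%g *m (itw_to e)^t*.
Proof.
move=> gG; rewrite -[LHS]mulmx1 -(itw_toK e) mulmxA -(mulmxA _ _ (itw_to e)).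
by rewrite itw_to_conj // !mulmxA itw_toVK mul1mx.
Qed.

Lemma Schur_itw_to x q1 q2 y z (e1 : dual_act x q1 = y) (e2 : dual_act y q2 = z)
    (e12 : dual_act x (q1 * q2)%g = z) :
  exists a : C, `|a| = 1 /\
    itw_to e2 *m itw_to e1 = a *: (itw_to e12 *m invmx (rep x (tau s q1 q2))).
Proof.
have tG := tau_in s q1 q2; have tU := repr_mx_unit (rep x) tG.
set N := itw_to e2 *m itw_to e1 *m rep x (tau s q1 q2).
have cA g : g \in G ->
  (itw_to e12)^t* *m N *m rep x g = rep x g *m ((itw_to e12)^t* *m N).
  move=> gG; set s12 := s (q1 * q2)%g.
  have hG := ext_sub_conjV s12 gG; set h := (_ * _ * _)%g in hG.
  have -> : g = (s12 * h * s12^-1)%g by rewrite /h !mulgA mulgV mul1g mulgK.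
  rewrite [RHS]mulmxA -itw_to_conjV // -!mulmxA; congr (_ *m _).
  rewrite /N !mulmxA (itw_to_conj e2 hG).
  rewrite -[in RHS](mulmxA (itw_to e2)) (itw_to_conj e1) ?ext_sub_conj //.
  rewrite -!mulmxA; congr (_ *m (_ *m _)).
  rewrite -!repr_mxM ?ext_sub_conj //; congr (rep x _).
  by rewrite /tau !mulgA !mulgKV.
have [a Ea] := Schur_scalar (rep_irr x) cA; exists a; split; last first.
  rewrite scalemxAl -mul_mx_scalar -Ea mulmxA itw_toK mul1mx.
  by rewrite /N mulmxK.
have : (itw_to e12)^t* *m N \is unitarymx.
  rewrite !mul_unitarymx ?itw_to_unitary ?itw_to_unitaryV //.
  exact: rep_unitary.
rewrite Ea => /unitarymxP; rewrite tr_scalar_mx map_scalar_mx -scalar_mxM.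
have [d_gt0 _] := iffLR (mx_irrP _) (rep_irr x).
move=> /matrixP/(_ (Ordinal d_gt0) (Ordinal d_gt0)); rewrite !mxE eqxx !mulr1n.
rewrite -normCK => /eqP; rewrite sqrp_eq1 ?normr_ge0 // => /eqP //.
Qed.

Lemma Schur_exists x q1 q2 : exists a : C, `|a| = 1 /\
  T (dual_act x q1) q2 *m T x q1 =
    a *: (idx_cast (actM dual_act x q1 q2) (T x (q1 * q2)%g)
            *m invmx (rep x (tau s q1 q2))).
Proof. exact: (Schur_itw_to (erefl _) (erefl _) (actM dual_act x q1 q2)). Qed.

Definition cocycle x q1 q2 : C := projT1 (cid (Schur_exists x q1 q2)).

Lemma cocycle_norm x q1 q2 : `|cocycle x q1 q2| = 1.
Proof. by case: (projT2 (cid (Schur_exists x q1 q2))). Qed.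

Lemma cocycleE x q1 q2 :
  T (dual_act x q1) q2 *m T x q1 =
    cocycle x q1 q2 *: (idx_cast (actM dual_act x q1 q2) (T x (q1 * q2)%g)
                          *m invmx (rep x (tau s q1 q2))).
Proof. by case: (projT2 (cid (Schur_exists x q1 q2))). Qed.

Lemma cocycle_itw_to x q1 q2 y z (e1 : dual_act x q1 = y)
    (e2 : dual_act y q2 = z)
    (e12 : dual_act x (q1 * q2)%g = z) :
  itw_to e2 *m itw_to e1 =
    cocycle x q1 q2 *: (itw_to e12 *m invmx (rep x (tau s q1 q2))).
Proof.
case: y / e1 e2 => e2; case: z / e2 e12 => e12.
by rewrite (eq_irrelevance e12 (actM dual_act x q1 q2)) -cocycleE.
Qed.

Lemma itw_to_scale_inj x q y (e : dual_act x q = y) g (a b : C) : g \in G ->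
  a *: (itw_to e *m rep x g) = b *: (itw_to e *m rep x g) -> a = b.
Proof.
move=> gG /(congr1 (fun M => (itw_to e)^t* *m M *m invmx (rep x g))).
rewrite -!scalemxAr -!scalemxAl !mulmxA itw_toVK mul1mx mulmxV ?repr_mx_unit //.
have [d_gt0 _] := iffLR (mx_irrP _) (rep_irr x).
move=> /matrixP/(_ (Ordinal d_gt0) (Ordinal d_gt0)).
by rewrite !mxE eqxx !mulr1.
Qed.

Lemma cocycle_unique x q1 q2 (a : C) :
  T (dual_act x q1) q2 *m T x q1 =
    a *: (idx_cast (actM dual_act x q1 q2) (T x (q1 * q2)%g)
            *m invmx (rep x (tau s q1 q2))) ->
  a = cocycle x q1 q2.
Proof.
rewrite cocycleE -repr_mxV ?tau_in // => /esym.
by apply: itw_to_scale_inj; rewrite groupV tau_in.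
Qed.

Lemma cocycle_eq x q1 q2 q3 :
  cocycle x q1 q2 * cocycle x (q1 * q2)%g q3 =
  cocycle (dual_act x q1) q2 q3 * cocycle x q1 (q2 * q3)%g.
Proof.
pose y := dual_act x q1; pose z := dual_act y q2; pose w := dual_act z q3.
have e1 : dual_act x q1 = y by []; have e2 : dual_act y q2 = z by [].
have e3 : dual_act z q3 = w by [].
have e12 : dual_act x (q1 * q2)%g = z by rewrite actM.
have e23 : dual_act y (q2 * q3)%g = w by rewrite actM.
have e123 : dual_act x (q1 * (q2 * q3))%g = w by rewrite !actM.
have e123' : dual_act x (q1 * q2 * q3)%g = w by rewrite !actM.
have itw_toE : itw_to e123' = itw_to e123.
  move: e123'; rewrite -mulgA => e123'.
  by rewrite (eq_irrelevance e123' e123).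
have := mulmxA (itw_to e3) (itw_to e2) (itw_to e1).
rewrite (cocycle_itw_to e1 e2 e12) (cocycle_itw_to e2 e3 e23).
rewrite -scalemxAr mulmxA (cocycle_itw_to e12 e3 e123').
rewrite -!scalemxAl scalerA itw_toE.
rewrite -!repr_mxV ?tau_in // -!mulmxA itw_to_conj ?groupV ?tau_in //.
rewrite (mulmxA (itw_to e23)) (cocycle_itw_to e1 e23 e123) -!scalemxAl scalerA.
rewrite -!repr_mxV ?tau_in // -!mulmxA -!repr_mxM ?groupV ?ext_sub_conj
  ?groupV ?tau_in //.
have -> : ((tau s q1 (q2 * q3))^-1 * (s q1 * (tau s q2 q3)^-1 * (s q1)^-1) =
           (tau s (q1 * q2) q3)^-1 * (tau s q1 q2)^-1)%g.
  rewrite /tau !(mulgA q1) !invMg !invgK !mulgA.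
  by rewrite !mulgKV.
by apply: itw_to_scale_inj; rewrite groupM ?groupV ?tau_in.
Qed.

Lemma itw_to1 x (e : dual_act x 1%g = x) : itw_to e = 1%:M.
Proof.
rewrite /itw_to itw1 /idx_cast castmx_comp /=.
by rewrite (eq_irrelevance (etrans _ _) (erefl _)) castmx_id.
Qed.

Lemma cocycle1l x q : cocycle x 1%g q = 1.
Proof.
have e1 : dual_act x 1%g = x by rewrite act1.
have e12 : dual_act x (1 * q)%g = dual_act x q by rewrite mul1g.
have itw_toE : itw_to e12 = itw_to (erefl (dual_act x q)).
  by move: (e12); rewrite mul1g => e; rewrite (eq_irrelevance e (erefl _)).
have := cocycle_itw_to e1 (erefl (dual_act x q)) e12.
have -> : tau s 1 q = 1%g by rewrite /tau sec1 !mul1g mulgV.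
rewrite itw_to1 itw_toE -repr_mxV ?group1 // invg1.
rewrite -[1%:M](repr_mx1 (rep x)) -[LHS]scale1r => /itw_to_scale_inj -> //.
Qed.

Lemma cocycle1r x q : cocycle x q 1%g = 1.
Proof.
set y := dual_act x q.
have e2 : dual_act y 1%g = y by rewrite act1.
have e12 : dual_act x (q * 1)%g = y by rewrite mulg1.
have itw_toE : itw_to e12 = itw_to (erefl y).
  by move: (e12); rewrite mulg1 => e; rewrite (eq_irrelevance e (erefl _)).
have := cocycle_itw_to (erefl y) e2 e12.
have -> : tau s q 1 = 1%g by rewrite /tau sec1 !mulg1 mulgV.
rewrite itw_to1 mul1mx itw_toE -repr_mxV ?group1 // invg1.
rewrite -[X in X = _ -> _]mulmx1 -[1%:M](repr_mx1 (rep x)).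
by rewrite -[X in X = _ -> _]scale1r => /itw_to_scale_inj ->.
Qed.

Lemma dual_nonempty : exists x : X, True.
Proof.
pose rho (g : hT) : 'M[C]_1 := 1%:M.
have rhoP : mx_repr G rho by split=> // g h _ _; rewrite /rho mulmx1.
have [||x _] := @rep_full _ _ _ X 1 (MxRepresentation rhoP); last by exists x.
- apply/mx_irrP; split=> // U _; rewrite -mxrank_eq0 /row_full.
  by have := rank_leq_row U; case: (\rank U) => [|[]].
- by move=> g gG; apply/unitarymxP; rewrite /= /rho trmx1 map_mx1 mulmx1.
Qed.

End Conjugation.

(* C(G^ x| Q, c), with its basis {([rho], q)}; a copy of the vector space of
   functions on G^ x Q, whose own ring structure is pointwise. *)
Section TwistedAlgebra.
Variables (C : numClosedFieldType) (gT hT qT : finGroupType).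
Variables (E : extension gT hT qT) (s : ext_section E).
Variable X : unitary_dual C (ext_sub E).

(* The parameter T only serves to select the product. *)
Definition twisted_algebra (T : intertwiners s X) : Type :=
  {ffun X * qT -> C^o}.

Variable T : intertwiners s X.
Local Notation TA := (twisted_algebra T).

HB.instance Definition _ :=
  GRing.Lmodule.copy TA {ffun X * qT -> C^o}.

Definition tga_basis_mul (u v : X * qT) : {ffun X * qT -> C^o} :=
  if v.1 == dual_act s X u.1 u.2
  then cocycle T u.1 u.2 v.2 *: basis_vec C (u.1, (u.2 * v.2)%g) else 0.

Definition tga_mul : TA -> TA -> TA :=
  bilin_ext tga_basis_mul.

Definition tga_one : TA := \sum_(x : X) basis_vec C (x, 1%g).

Let mulZl c f g : tga_mul (c *: f) g = c *: tga_mul f g.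
Proof. exact: (is_linearZ (bilin_ext_linearl _ g) c f). Qed.

Let mulZr c f g : tga_mul f (c *: g) = c *: tga_mul f g.
Proof. exact: (is_linearZ (bilin_ext_linearr _ f) c g). Qed.

Let mul0 f : tga_mul 0 f = 0.
Proof. exact: (is_linear0 (bilin_ext_linearl _ f)). Qed.

Let mulr0 f : tga_mul f 0 = 0.
Proof. exact: (is_linear0 (bilin_ext_linearr _ f)). Qed.

Fact tga_mulA : associative tga_mul.
Proof.
apply: bilin_extA => -[x p] [y q] [z r]; rewrite -![bilin_ext _]/tga_mul.
rewrite /tga_basis_mul /=.
have act2 := dual_actM s x p q; have coc2 := cocycle_eq T x p q r.
have [->|ny] := eqVneq y (dual_act_fun s x p); last first.
  rewrite mul0; case: ifP => _; last by rewrite mulr0.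
  by rewrite mulZr [tga_mul _ _]bilin_ext_basis /tga_basis_mul /=
    (negPf ny) scaler0.
rewrite mulZl [tga_mul _ (basis_vec _ (z, r))]bilin_ext_basis.
rewrite /tga_basis_mul /= act2; case: ifP => _; last by rewrite mulr0 scaler0.
rewrite mulZr [tga_mul _ _]bilin_ext_basis /tga_basis_mul /= eqxx
  !scalerA mulgA.
by rewrite [in RHS]coc2.
Qed.

Fact tga_mul1 : left_id tga_one tga_mul.
Proof.
apply: bilin_ext1l => -[x q].
rewrite (big_morph _ (is_linearD (bilin_ext_linearl _ _))
                      (is_linear0 (bilin_ext_linearl _ _))).
rewrite (bigD1 x) //= bilin_ext_basis /tga_basis_mul /= dual_act1 eqxx.
rewrite cocycle1l scale1r mul1g big1 ?addr0 // => y /negPf yx.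
by rewrite bilin_ext_basis /tga_basis_mul /= dual_act1 eq_sym yx.
Qed.

Fact tga_mulr1 : right_id tga_one tga_mul.
Proof.
apply: bilin_ext1r => -[x q].
rewrite (big_morph _ (is_linearD (bilin_ext_linearr _ _))
                      (is_linear0 (bilin_ext_linearr _ _))).
rewrite (bigD1 (dual_act_fun s x q)) //= bilin_ext_basis /tga_basis_mul /= eqxx.
rewrite cocycle1r scale1r mulg1 big1 ?addr0 // => y /negPf yx.
by rewrite bilin_ext_basis /tga_basis_mul /= yx.
Qed.

Fact tga_one_neq0 : tga_one != 0.
Proof.
have [x _] := dual_nonempty X.
apply/eqP=> /ffunP/(_ (x, 1%g))/eqP; rewrite sum_ffunE !ffunE.
rewrite (bigD1 x) //= big1 => [|y /negPf yx]; last first.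
  by rewrite ffunE xpair_eqE eq_sym yx.
by rewrite ffunE eqxx addr0 oner_eq0.
Qed.

HB.instance Definition _ := GRing.Zmodule_isNzRing.Build TA
  tga_mulA tga_mul1 tga_mulr1 (@bilin_extDl _ _ _) (@bilin_extDr _ _ _)
  tga_one_neq0.

Fact tga_scaleAl c (f g : TA) : c *: (f * g) = (c *: f) * g.
Proof. exact: esym (mulZl c f g). Qed.

HB.instance Definition _ :=
  GRing.Lmodule_isLalgebra.Build C TA tga_scaleAl.

Fact tga_scaleAr c (f g : TA) : c *: (f * g) = f * (c *: g).
Proof. exact: esym (mulZr c f g). Qed.

HB.instance Definition _ :=
  GRing.Lalgebra_isAlgebra.Build C TA tga_scaleAr.

End TwistedAlgebra.

(* Main.v *)
From HB Require Import structures.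
From mathcomp Require Import all_boot all_order all_fingroup all_algebra.
From mathcomp Require Import pgroup spectral mxrepresentation.
From mathcomp Require Import boolp reals complex ring.
(* Imported last, so that [ract] is the right action of a bimodule. *)
Require Import Defs.

Set Implicit Arguments.
Unset Strict Implicit.
Unset Printing Implicit Defensive.

Import Order.TTheory GRing.Theory Num.Theory.
Local Open Scope ring_scope.
Local Open Scope sesquilinear_scope.

(** Write G for the kernel of j : H -> Q, A for the group algebra CH and B for
    the twisted groupoid algebra. The proof embeds B as a full corner eAe of A.

    For an arrow x -> y = q(x) of the action groupoid and h in H with j(h) = q,
    the unitary map [transport] V_x -> V_y,
      R(x, h) = T_q^x o rho_x(s(q) h^-1),
    extends h = s(q) |-> T_q^x and g |-> rho_x(g)^-1, and satisfies
      R(y, h2) R(x, h1) = c^x(q1, q2) R(x, h1 h2)        ([transportM]).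
    Hence h |-> sum_x R(x, h)^-1 (x, j(h)) is an algebra morphism from A to the
    twisted matrix algebra M whose elements are sums of m (x, q), for m a linear
    map V_q(x) -> V_x. It is bijective; its inverse maps m (x, q) to
      sum_(j(h) = q) d_x / |G| tr(m R(x, h)) h           ([inv_fourier]).
    These elements of A multiply as in M, by Schur orthogonality
    ([inv_fourierM], [inv_fourierM0]), and they span A, by the decomposition of
    the regular character of G ([dual_regular_character],
    [inv_fourier_complete]). As only
    unitary irreducible representations are indexed by the dual, the latter uses
    that every simple submodule of the regular representation, which is unitary,
    is unitary in an orthonormal basis.

    Fix a basis vector in each V_x and let E_xy : V_y -> V_x be the elementary
    matrix at the chosen vectors. Then (x, q) |-> E_xy (x, q), with y = q(x),
    identifies B with eAe, where e = sum_x E_xx (x, 1) ([cornerM], [corner_inj],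
    [corner_surj]). The corner is full, AeA = A, since the elementary projection
    at any basis vector of V_x factors through the chosen one ([corner_full]).
    Finally the bimodules Ae and eA form a Morita equivalence between A and any
    full corner eAe ([full_corner_morita]). *)

(** * Full corners *)

Section OneSidedIdeals.
Variables (F : fieldType) (A : algType F) (e : A).

(** For e idempotent, the left ideal Ae is the set of a with a e = a, and eA is
    the set of a with e a = a. *)
Definition left_fixed : pred A := fun a => a * e == a.
Definition right_fixed : pred A := fun a => e * a == a.

Fact left_fixed_submod : submod_closed left_fixed.
Proof.
split=> [|c a b]; rewrite !unfold_in ?mul0r // => /eqP ea /eqP eb.
by rewrite mulrDl -scalerAl ea eb.
Qed.

Fact right_fixed_submod : submod_closed right_fixed.
Proof.
split=> [|c a b]; rewrite !unfold_in ?mulr0 // => /eqP ea /eqP eb.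
by rewrite mulrDr -scalerAr ea eb.
Qed.

HB.instance Definition _ :=
  GRing.isSubmodClosed.Build F A left_fixed left_fixed_submod.
HB.instance Definition _ :=
  GRing.isSubmodClosed.Build F A right_fixed right_fixed_submod.

(** Ae and eA as vector spaces over F, for e idempotent. *)
Record left_ideal := LeftIdeal {
  left_val : A; left_valP : left_val \in left_fixed }.
Record right_ideal := RightIdeal {
  right_val : A; right_valP : right_val \in right_fixed }.

HB.instance Definition _ := [isSub for left_val].
HB.instance Definition _ := [Choice of left_ideal by <:].
HB.instance Definition _ := [SubChoice_isSubLmodule of left_ideal by <:].
HB.instance Definition _ := [isSub for right_val].
HB.instance Definition _ := [Choice of right_ideal by <:].
HB.instance Definition _ := [SubChoice_isSubLmodule of right_ideal by <:].

Lemma left_idealE (p : left_ideal) : left_val p * e = left_val p.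
Proof. exact/eqP/left_valP. Qed.

Lemma right_idealE (p : right_ideal) : e * right_val p = right_val p.
Proof. exact/eqP/right_valP. Qed.

Lemma left_val_inj : injective left_val. Proof. exact: val_inj. Qed.
Lemma right_val_inj : injective right_val. Proof. exact: val_inj. Qed.

Lemma left_valL c (p q : left_ideal) :
  left_val (c *: p + q) = c *: left_val p + left_val q.
Proof. by []. Qed.

Lemma right_valL c (p q : right_ideal) :
  right_val (c *: p + q) = c *: right_val p + right_val q.
Proof. by []. Qed.

End OneSidedIdeals.

(** A balanced pairing P x P' -> N compatible with the outer actions induces an
    isomorphism of bimodules from the tensor product to N as soon as it has an
    inverse in the stated sense. *)
Lemma tensor_iso (F : fieldType) (A B D : algType F) (P : bimodule A B)
    (P' : bimodule B D) (N : bimodule A D) (f : P -> P' -> N)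
    (inv : N -> tensor_space P P') :
  (forall p', linear (f^~ p')) -> (forall p, linear (f p)) ->
  (forall p b p', f (ract p b) p' = f p (lact b p')) ->
  (forall a p p', f (lact a p) p' = lact a (f p p')) ->
  (forall p p' d, f p (ract p' d) = ract (f p p') d) ->
  linear inv -> (forall p p', inv (f p p') = tensor p p') ->
  (forall n, tensor_lift f (inv n) = n) ->
  bimodule_iso (tensor_bimodule P P') N.
Proof.
move=> fLl fLr fB flact fract invL fK invK.
have phiL : linear (tensor_lift f : tensor_space P P' -> N).
  exact: tensor_lift_linear.
have phiE p p' : tensor_lift f (tensor p p') = f p p' by exact: tensor_liftE.
pose phi := HB.pack_for {linear (tensor_bimodule P P') -> N}
  (tensor_lift f : tensor_space P P' -> N)
  (GRing.isLinear.Build F (tensor_bimodule P P') N _ _ phiL).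
exists phi; split; rewrite /=.
- exists inv => // t.
  move: t; apply: tensor_linear_ext => [c t t'|//|p p'].
    by rewrite phiL invL.
  by rewrite phiE fK.
- move=> a t; move: t; apply: tensor_linear_ext => [c t t'|c t t'|p p'].
  + by rewrite tensor_lact_linearr phiL.
  + by rewrite phiL lact_linearr.
  + by rewrite tensor_lactE !phiE.
- move=> t d; move: t; apply: tensor_linear_ext => [c t t'|c t t'|p p'].
  + by rewrite tensor_ract_linearl phiL.
  + by rewrite phiL /= ract_linearl.
  + by rewrite tensor_ractE !phiE.
Qed.

Section FullCorner.
(** [theta] is multiplicative but need not be unital: it maps 1 to the
    idempotent e that cuts out the corner. *)
Variables (F : fieldType) (A B : algType F) (theta : {linear B -> A}).
Hypothesis thetaM : {morph theta : b b' / b * b'}.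
Let e := theta 1.

Fact corner_idem : e * e = e.
Proof. by rewrite /e -thetaM mulr1. Qed.

Let thetae b : theta b * e = theta b.
Proof. by rewrite -thetaM mulr1. Qed.

Let etheta b : e * theta b = theta b.
Proof. by rewrite -thetaM mul1r. Qed.

Fact left_lact_in (a : A) (p : left_ideal e) : a * left_val p \in left_fixed e.
Proof. by rewrite unfold_in -mulrA left_idealE. Qed.
Fact left_ract_in (p : left_ideal e) b : left_val p * theta b \in left_fixed e.
Proof. by rewrite unfold_in -mulrA thetae. Qed.
Fact right_lact_in b (p : right_ideal e) :
  theta b * right_val p \in right_fixed e.
Proof. by rewrite unfold_in mulrA etheta. Qed.
Fact right_ract_in (p : right_ideal e) (a : A) :
  right_val p * a \in right_fixed e.
Proof. by rewrite unfold_in mulrA right_idealE. Qed.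

Definition left_lact a p := LeftIdeal (left_lact_in a p).
Definition left_ract p b := LeftIdeal (left_ract_in p b).
Definition right_lact b p := RightIdeal (right_lact_in b p).
Definition right_ract p a := RightIdeal (right_ract_in p a).

(** Ae as an A-B bimodule, and eA as a B-A bimodule; B acts through [theta]. *)
Definition left_bimodule : bimodule A B.
Proof.
apply: (@Bimodule F A B (left_ideal e) left_lact left_ract).
- by move=> p c a a'; apply: left_val_inj; rewrite left_valL /= mulrDl scalerAl.
- by move=> a c p q; apply: left_val_inj; rewrite left_valL /= mulrDr scalerAr.
- by move=> p; apply: left_val_inj; rewrite /= mul1r.
- by move=> a a' p; apply: left_val_inj; rewrite /= mulrA.
- by move=> b c p q; apply: left_val_inj; rewrite left_valL /= mulrDl scalerAl.
- move=> p c b b'; apply: left_val_inj.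
  by rewrite left_valL /= linearP mulrDr scalerAr.
- by move=> p; apply: left_val_inj; rewrite /= left_idealE.
- by move=> p b b'; apply: left_val_inj; rewrite /= thetaM mulrA.
- by move=> a p b; apply: left_val_inj; rewrite /= mulrA.
Defined.

Definition right_bimodule : bimodule B A.
Proof.
apply: (@Bimodule F B A (right_ideal e) right_lact right_ract).
- move=> p c b b'; apply: right_val_inj.
  by rewrite right_valL /= linearP mulrDl scalerAl.
- move=> a c p q; apply: right_val_inj.
  by rewrite right_valL /= mulrDr scalerAr.
- by move=> p; apply: right_val_inj; rewrite /= right_idealE.
- by move=> b b' p; apply: right_val_inj; rewrite /= thetaM mulrA.
- move=> b c p q; apply: right_val_inj.
  by rewrite right_valL /= mulrDl scalerAl.
- move=> p c a a'; apply: right_val_inj.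
  by rewrite right_valL /= mulrDr scalerAr.
- by move=> p; apply: right_val_inj; rewrite /= mulr1.
- by move=> p a a'; apply: right_val_inj; rewrite /= mulrA.
- by move=> b p a; apply: right_val_inj; rewrite /= mulrA.
Defined.

(** Henceforth [theta] is an isomorphism from B to eAe, and AeA = A. *)
Hypothesis theta_inj : injective theta.
Hypothesis theta_corner : forall a, exists b, theta b = e * a * e.
Variables (I : finType) (u v : I -> A).
Hypothesis full : \sum_i u i * e * v i = 1.

Let kappa a : B := projT1 (cid (theta_corner a)).
Let thetaK a : theta (kappa a) = e * a * e.
Proof. exact: projT2 (cid (theta_corner a)). Qed.

Let kappa_linear : linear kappa.
Proof.
move=> c a a'; apply: theta_inj; rewrite linearP !thetaK.
by rewrite mulrDr mulrDl -scalerAr -scalerAl.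
Qed.

Fact left_mulr_in a : a * e \in left_fixed e.
Proof. by rewrite unfold_in -mulrA corner_idem. Qed.
Fact right_mull_in a : e * a \in right_fixed e.
Proof. by rewrite unfold_in mulrA corner_idem. Qed.

Local Notation P := left_bimodule.
Local Notation P' := right_bimodule.
Let lft a : P := LeftIdeal (left_mulr_in a).
Let rgt a : P' := RightIdeal (right_mull_in a).

Let pairA (p : P) (p' : P') : A := left_val p * right_val p'.
Let pairA_linearl p' : linear (pairA^~ p').
Proof. by move=> c p q; rewrite /pairA left_valL mulrDl scalerAl. Qed.
Let pairA_linearr p : linear (pairA p).
Proof. by move=> c p' q'; rewrite /pairA right_valL mulrDr scalerAr. Qed.
Let pairA_balanced p b p' : pairA (ract p b) p' = pairA p (lact b p').
Proof. by rewrite /pairA /= mulrA. Qed.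

Let pairB (p' : P') (p : P) : B := kappa (right_val p' * left_val p).
Let pairB_linearl p : linear (pairB^~ p).
Proof.
by move=> c p' q'; rewrite /pairB right_valL mulrDl -scalerAl kappa_linear.
Qed.
Let pairB_linearr p' : linear (pairB p').
Proof.
by move=> c p q; rewrite /pairB left_valL mulrDr -scalerAr kappa_linear.
Qed.
Let pairB_balanced p' a p : pairB (ract p' a) p = pairB p' (lact a p).
Proof. by rewrite /pairB /= mulrA. Qed.

(** Multiplication Ae (x)_B eA -> A; its inverse maps a to the sum of the
    a u_i e (x) e v_i, for 1 = sum_i u_i e v_i. *)
Lemma corner_iso_left :
  bimodule_iso (tensor_bimodule P P') (regular_bimodule A).
Proof.
pose inv a : tensor_space P P' := \sum_i tensor (lft (a * u i)) (rgt (v i)).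
apply: (@tensor_iso _ _ _ _ P P' (regular_bimodule A) pairA inv) => //.
- by move=> a p p'; rewrite /pairA /= mulrA.
- by move=> p p' a; rewrite /pairA /= mulrA.
- move=> c a a'; rewrite /inv scaler_sumr -big_split; apply: eq_bigr => i _.
  have -> : lft ((c *: a + a') * u i) = c *: lft (a * u i) + lft (a' * u i).
    by apply: left_val_inj; rewrite left_valL /= !mulrDl -!scalerAl.
  by rewrite tensor_linearl.
- move=> p p'; rewrite /inv.
  (* The element p' u_i e lies in eAe, hence comes from B and can be moved
     across the tensor sign. *)
  have split_left i : tensor (lft (pairA p p' * u i)) (rgt (v i)) =
      tensor p (ract p' (u i * e * v i)).
    have -> : lft (pairA p p' * u i) = ract p (kappa (right_val p' * u i)).
      apply: left_val_inj; rewrite /= thetaK [e * _]mulrA right_idealE.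
      by rewrite /pairA !mulrA.
    rewrite tensor_balanced; congr (tensor _ _); apply: right_val_inj.
    rewrite /= thetaK [e * _]mulrA right_idealE !mulrA -(mulrA _ e e).
    by rewrite corner_idem.
  rewrite (eq_bigr _ (fun i _ => split_left i)) -[in RHS](ract1 p') -full.
  rewrite (big_morph _ (is_linearD (ract_linearr p'))
                       (is_linear0 (ract_linearr p'))).
  by rewrite (big_morph _ (is_linearD (tensor_linearr p))
                          (is_linear0 (tensor_linearr p))).
- have phiL : linear (tensor_lift pairA) by exact: tensor_lift_linear.
  move=> a; rewrite /inv (big_morph _ (is_linearD phiL) (is_linear0 phiL)).
  rewrite -[RHS]mulr1 -full mulr_sumr; apply: eq_bigr => i _.
  by rewrite tensor_liftE // /pairA /= !mulrA -(mulrA _ e e) corner_idem.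
Qed.

(** Multiplication eA (x)_A Ae -> eAe = B; its inverse maps b to
    theta(b) (x) e. *)
Lemma corner_iso_right :
  bimodule_iso (tensor_bimodule P' P) (regular_bimodule B).
Proof.
have kappaE (p' : P') (p : P) : theta (pairB p' p) = right_val p' * left_val p.
  by rewrite thetaK mulrA right_idealE -mulrA left_idealE.
pose inv b : tensor_space P' P := tensor (rgt (theta b)) (lft 1).
apply: (@tensor_iso _ _ _ _ P' P (regular_bimodule B) pairB inv) => //.
- move=> b p' p; apply: theta_inj; rewrite /= thetaM !kappaE /=.
  by rewrite mulrA.
- move=> p' p b; apply: theta_inj; rewrite /= thetaM !kappaE /=.
  by rewrite mulrA.
- move=> c b b'; rewrite /inv.
  have -> : rgt (theta (c *: b + b')) = c *: rgt (theta b) + rgt (theta b').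
    by apply: right_val_inj; rewrite right_valL /= linearP mulrDr -scalerAr.
  by rewrite tensor_linearl.
- move=> p' p; rewrite /inv kappaE.
  have -> : rgt (right_val p' * left_val p) = ract p' (left_val p).
    by apply: right_val_inj; rewrite /= mulrA right_idealE.
  rewrite tensor_balanced; congr (tensor _ _); apply: left_val_inj.
  by rewrite /= mul1r left_idealE.
- move=> b; rewrite tensor_liftE //; apply: theta_inj.
  by rewrite kappaE /= mul1r etheta thetae.
Qed.

(** An algebra is Morita equivalent to any of its full corners. *)
Lemma full_corner_morita : morita_equivalent A B.
Proof.
by exists P, P'; split; [exact: corner_iso_left | exact: corner_iso_right].
Qed.

End FullCorner.

(** * Schur orthogonality *)

Section Schur.
Variables (C : numClosedFieldType) (gT : finGroupType) (G : {group gT}).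

(** Schur's lemma between irreducible representations of possibly different
    degrees. *)
Lemma mx_Schur_rsim n m (rG : mx_representation C G n)
    (rH : mx_representation C G m) (f : 'M_(n, m)) :
  mx_irreducible rG -> mx_irreducible rH ->
  (forall g, g \in G -> rG g *m f = f *m rH g) -> f != 0 -> mx_rsim rG rH.
Proof.
move=> /mx_irrP[_ irrG] /mx_irrP[_ irrH] fJ nz_f.
have freef : row_free f.
  rewrite -kermx_eq0; apply: contraR nz_f => nz_ker.
  have kermod : mxmodule rG (kermx f).
    apply/mxmoduleP=> g gG; apply/sub_kermxP.
    by rewrite -mulmxA fJ // mulmxA mulmx_ker mul0mx.
  have /(row_full_inj (irrG _ kermod nz_ker)) : kermx f *m f = kermx f *m 0.
    by rewrite mulmx_ker mulmx0.
  by move->.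
have fullf : row_full f.
  have -> : row_full f = row_full <<f>>%MS by rewrite /row_full genmxE.
  apply: irrH; last by rewrite -mxrank_eq0 genmxE mxrank_eq0.
  apply/mxmoduleP=> g gG; rewrite genmxE (eqmxMr _ (genmxE f)) -fJ //.
  exact: submxMl.
by exists f => //; rewrite -(eqP freef) (eqP fullf).
Qed.

Section Average.
Variables (n m : nat) (rG : mx_representation C G n).
Variables (rH : mx_representation C G m).

(** The sum over G of the conjugates of b, which intertwines [rG] and [rH]. *)
Definition Schur_average (b : 'M[C]_(n, m)) : 'M_(n, m) :=
  \sum_(g in G) rG g^-1%g *m b *m rH g.

Lemma Schur_averageJ b h : h \in G ->
  rG h *m Schur_average b = Schur_average b *m rH h.
Proof.
move=> hG; rewrite /Schur_average mulmx_sumr mulmx_suml.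
rewrite [LHS](reindex_astabs 'R h) /= ?astabsR //=.
apply: eq_bigr => g gG; rewrite invMg repr_mxM ?groupV //.
by rewrite [rH _]repr_mxM // !mulmxA -repr_mxM ?groupV // mulgV repr_mx1 mul1mx.
Qed.

Lemma Schur_average_coef (i : 'I_n) k l (j : 'I_m) :
  Schur_average (delta_mx k l) i j = \sum_(g in G) rG g^-1%g i k * rH g l j.
Proof.
rewrite summxE; apply: eq_bigr => g _.
rewrite -(mul_delta_mx (0 : 'I_1)) mulmxA -mulmxA -colE -rowE mxE big_ord1.
by rewrite !mxE.
Qed.

(** Sums of products of matrix coefficients are read off from the averages of
    the elementary matrices. *)
Lemma Schur_average_trace (a : 'M[C]_n) l j :
  (\sum_(g in G) \tr (a *m rG g^-1%g) *: rH g) l j =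
  \sum_i \sum_k a k i * Schur_average (delta_mx k l) i j.
Proof.
rewrite summxE exchange_big /=.
under [RHS]eq_bigr => k _ do under eq_bigr => i _ do
  rewrite Schur_average_coef mulr_sumr.
under [RHS]eq_bigr => k _ do rewrite exchange_big /=.
rewrite [RHS]exchange_big /=; apply: eq_bigr => g _.
rewrite mxE /mxtrace mulr_suml; apply: eq_bigr => k _.
by rewrite mxE mulr_suml; apply: eq_bigr => i _; rewrite mulrA.
Qed.

Lemma Schur_orthogonal (a : 'M[C]_n) :
  mx_irreducible rG -> mx_irreducible rH -> ~ mx_rsim rG rH ->
  \sum_(g in G) \tr (a *m rG g^-1%g) *: rH g = 0.
Proof.
move=> irrG irrH nsim; apply/matrixP=> l j; rewrite Schur_average_trace mxE.
rewrite big1 // => i _; rewrite big1 // => k _.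
suff -> : Schur_average (delta_mx k l) = 0 by rewrite mxE mulr0.
apply/eqP/negPn/negP=> nz; apply: nsim.
by apply: mx_Schur_rsim nz => // g gG; apply: Schur_averageJ.
Qed.

End Average.

Lemma card_neq0 : #|G|%:R != 0 :> C.
Proof. by rewrite pnatr_eq0 -lt0n cardG_gt0. Qed.

Lemma irr_dim_neq0 n (rG : mx_representation C G n) :
  mx_irreducible rG -> n%:R != 0 :> C.
Proof. by case/mx_irrP=> n_gt0 _; rewrite pnatr_eq0 -lt0n. Qed.

Lemma Schur_average_irr n (rG : mx_representation C G n) (b : 'M_n) :
  mx_irreducible rG -> Schur_average rG rG b = (#|G|%:R / n%:R * \tr b)%:M.
Proof.
move=> irrG.
have [|a Ea] := @Schur_scalar _ _ _ _ rG (Schur_average rG rG b) irrG.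
  by move=> g gG; rewrite Schur_averageJ.
have := congr1 mxtrace Ea; rewrite [X in _ -> X = _]Ea.
rewrite mxtrace_scalar /Schur_average raddf_sum /=.
under eq_bigr => g gG do
  rewrite mxtrace_mulC mulmxA -repr_mxM ?groupV // mulgV repr_mx1 mul1mx.
rewrite sumr_const -[X in X = _ -> _]mulr_natl -[X in _ = X -> _]mulr_natl.
move=> trE; congr _%:M; apply: (mulfI (irr_dim_neq0 irrG)).
rewrite -trE mulrA mulrCA mulfV ?mulr1 //.
exact: irr_dim_neq0 irrG.
Qed.

Lemma mxtrace_delta n (k l : 'I_n) : \tr (delta_mx k l : 'M[C]_n) = (k == l)%:R.
Proof.
rewrite /mxtrace (bigD1 k) //= mxE eqxx big1 ?addr0 // => i /negPf ik.
by rewrite mxE ik.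
Qed.

Lemma Schur_orthogonality n (rG : mx_representation C G n) (a : 'M_n) :
  mx_irreducible rG ->
  \sum_(g in G) \tr (a *m rG g^-1%g) *: rG g = (#|G|%:R / n%:R) *: a.
Proof.
move=> irrG; apply/matrixP=> l j; rewrite Schur_average_trace mxE.
rewrite (bigD1 j) //= (bigD1 l) //= !big1 ?addr0 => [|i ij|k kl].
- rewrite Schur_average_irr // mxE eqxx mulr1n mxtrace_delta eqxx mulr1.
  exact: mulrC.
- rewrite big1 // => k _; rewrite Schur_average_irr // mxE (negPf ij).
  by rewrite mulr0n mulr0.
- rewrite Schur_average_irr // mxtrace_delta (negPf kl) mulr0 mxE mul0rn.
  exact: mulr0.
Qed.

End Schur.

(** * Completeness of the unitary dual *)

Section Completeness.
Variables (C : numClosedFieldType) (gT : finGroupType) (G : {group gT}).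
Local Notation aG := (regular_repr C G).

Lemma regular_unitary g : g \in G -> aG g \is unitarymx.
Proof.
move=> gG; apply/unitarymxP/matrixP=> i k; rewrite !mxE.
pose f (i : 'I_(gcard G)) := gring_index G (enum_val i * g)%g.
have f_inj : injective f.
  move=> i1 i2 /(congr1 enum_val); rewrite !gring_indexK ?groupM ?enum_valP //.
  by move=> /mulIg/enum_val_inj.
rewrite (bigD1 (f i)) //= big1 ?addr0 => [|j /negPf fj].
  by rewrite !mxE !eqxx mul1r rmorph_nat (inj_eq f_inj).
by rewrite !mxE fj mul0r.
Qed.

Section OrthonormalRestriction.
Variables (n : nat) (rG : mx_representation C G n) (U : 'M[C]_n).
Hypotheses (rG_unitary : forall g, g \in G -> rG g \is unitarymx).
Hypothesis modU : mxmodule rG U.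

(** The rows form an orthonormal basis of the row space of U. *)
Definition orthonormal_base : 'M[C]_(\rank U, n) := schmidt (row_base U).
Local Notation B := orthonormal_base.

Lemma orthonormal_base_unitary : B \is unitarymx.
Proof. exact/schmidt_unitarymx/rank_leq_col. Qed.

Lemma eq_orthonormal_base : (B :=: U)%MS.
Proof.
exact: eqmx_trans (eqmx_schmidt_free (row_base_free U)) (eq_row_base U).
Qed.

Lemma orthonormal_baseK m (W : 'M_(m, n)) : (W <= U)%MS -> W *m B^t* *m B = W.
Proof.
rewrite -eq_orthonormal_base => /submxP[D ->].
by rewrite -(mulmxA D) (unitarymxP orthonormal_base_unitary) mulmx1.
Qed.

(** The action of G on the submodule U, in the basis [orthonormal_base]. *)
Definition orthonormal_mx g := B *m rG g *m B^t*.

Lemma orthonormal_mxJ g : g \in G -> orthonormal_mx g *m B = B *m rG g.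
Proof.
move=> gG; apply: orthonormal_baseK.
by rewrite (eqmxMr _ eq_orthonormal_base) (mxmoduleP modU).
Qed.

Fact orthonormal_mx_repr : mx_repr G orthonormal_mx.
Proof.
split=> [|g h gG hG].
  rewrite /orthonormal_mx repr_mx1 mulmx1.
  exact/unitarymxP/orthonormal_base_unitary.
by rewrite [RHS]mulmxA mulmxA orthonormal_mxJ // -(mulmxA B) -repr_mxM.
Qed.

Definition orthonormal_repr := MxRepresentation orthonormal_mx_repr.

Lemma orthonormal_repr_unitary g : g \in G -> orthonormal_repr g \is unitarymx.
Proof.
move=> gG; apply/unitarymxP; rewrite [X in _ *m X^t*]/= /orthonormal_mx.
rewrite !trmx_mul !map_mxM trmxCK !mulmxA orthonormal_mxJ //.
rewrite -(mulmxA B) (unitarymxP (rG_unitary gG)) mulmx1.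
exact/unitarymxP/orthonormal_base_unitary.
Qed.

Lemma orthonormal_repr_rsim : mx_rsim (submod_repr modU) orthonormal_repr.
Proof.
have subU m (W : 'M_(m, \rank U)) : (val_submod W <= U)%MS.
  exact: val_submodP.
exists (val_submod 1%:M *m B^t*) => // [|g gG].
  rewrite /row_free eqn_leq rank_leq_row /=.
  rewrite -{1}(val_submod1 U) -{1}(orthonormal_baseK (subU _ 1%:M)).
  exact: mxrankM_maxl.
rewrite [RHS]mulmxA [in RHS]mulmxA orthonormal_baseK // mulmxA -val_submodE.
by rewrite -[submod_repr modU g]mul1mx val_submodJ.
Qed.

End OrthonormalRestriction.

Variable X : unitary_dual C G.

(** The unitary irreducible representations jointly separate the points of CG:
    an element killed by all of them kills every simple submodule of the regular
    representation, hence is 0 by Maschke's theorem. *)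
Lemma dual_complete (f : gT -> C) :
  (forall x : X, \sum_(g in G) f g *: rep x g = 0) ->
  forall g, g \in G -> f g = 0.
Proof.
move=> f0; pose M := \sum_(g in G) f g *: aG g.
suff /eqP M0 : M == 0.
  move=> g gG; have E : gring_proj g M = \sum_(h in G) f h *: (g == h)%:R.
    rewrite linear_sum; apply: eq_bigr => h hG.
    by rewrite linearZ; congr (_ *: _); apply: gring_projE.
  move: E; rewrite M0 linear0 (bigD1 g) //= eqxx big1 ?addr0.
    by move=> /matrixP/(_ 0 0); rewrite !mxE mulr1 => <-.
  by move=> h /andP[_ /negPf hg]; rewrite eq_sym hg scaler0.
(* A simple U is isomorphic to some [rep x], via its orthonormal basis. *)
have kill U : mxsimple aG U -> U *m M = 0.
  move=> simU; have [modU _ _] := simU.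
  have [||x [B _ freeB homB]] := @rep_full _ _ _ X _ (orthonormal_repr modU).
  - apply: mx_rsim_irr (orthonormal_repr_rsim modU) _.
    exact/submod_mx_irr.
  - exact/orthonormal_repr_unitary/regular_unitary.
  have orth0 : \sum_(g in G) f g *: orthonormal_mx aG U g = 0.
    apply: (row_free_inj freeB); rewrite mul0mx mulmx_suml.
    under eq_bigr => g gG do rewrite -scalemxAl homB // scalemxAr.
    by rewrite -mulmx_sumr f0 mulmx0.
  have /submxP[D ->] : (U <= orthonormal_base U)%MS.
    by rewrite eq_orthonormal_base.
  rewrite -mulmxA (_ : _ *m M = 0) ?mulmx0 // mulmx_sumr.
  transitivity
    ((\sum_(g in G) f g *: orthonormal_mx aG U g) *m orthonormal_base U).
    rewrite mulmx_suml; apply: eq_bigr => g gG.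
    by rewrite -scalemxAr -scalemxAl orthonormal_mxJ.
  by rewrite orth0 mul0mx.
have charG : ([pchar C]^'.-group G)%g.
  by rewrite /pgroup pcharf'_nat card_neq0.
have := mx_reducible_semisimple (mxmodule1 aG) (mx_Maschke_pchar aG charG).
apply=> -[I U W simU defW _]; rewrite -[M]mul1mx -submx0 -(eqmxMr _ defW).
by rewrite sumsmxMr; apply/sumsmx_subP=> i _; rewrite kill.
Qed.

(** The column orthogonality relation at the identity, i.e., the decomposition
    of the regular character. *)
Lemma dual_regular_character g : g \in G ->
  \sum_(x : X) (rep_dim x)%:R / #|G|%:R * \tr (rep x g) = (g == 1%g)%:R.
Proof.
move=> gG; apply/eqP; rewrite eq_sym -subr_eq0; apply/eqP.
pose f h := (h == 1%g)%:R -
  \sum_(x : X) (rep_dim x)%:R / #|G|%:R * \tr (rep x h^-1%g).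
(* f is the indicator of 1 minus the claimed formula; by orthogonality every
   representation kills it. *)
have f0 (x : X) : \sum_(h in G) f h *: rep x h = 0.
  under eq_bigr => h _ do rewrite scalerBl scaler_suml.
  rewrite sumrB (bigD1 1%g) //= eqxx scale1r big1 => [|h /andP[_ /negPf ->]].
    rewrite addr0; apply/eqP; rewrite subr_eq0 exchange_big; apply/eqP.
    rewrite (bigD1 x) //= [X in _ + X]big1 ?addr0 => [|y yx].
      under eq_bigr => h _ do rewrite -scalerA -[rep x h^-1%g]mul1mx.
      rewrite -scaler_sumr Schur_orthogonality ?scalerA; last exact: rep_irr.
      rewrite mulrA mulfVK ?card_neq0 // mulfV ?scale1r ?repr_mx1 //.
      exact: irr_dim_neq0 (rep_irr x).
    under eq_bigr => h _ do rewrite -scalerA -[rep y h^-1%g]mul1mx.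
    rewrite -scaler_sumr Schur_orthogonal ?scaler0 //; try exact: rep_irr.
    by move=> /(@rep_inj _ _ _ X) /eqP; rewrite (negPf yx).
  by rewrite scale0r.
by have := dual_complete f0 (groupVr gG); rewrite /f invgK eq_invg1.
Qed.

End Completeness.

(** * Convolution and traces *)

Section GroupAlgebraFacts.
Variables (F : fieldType) (gT : finGroupType).
Implicit Types a b : group_algebra F gT.

Lemma ga_mulE a b h : (a * b) h = \sum_g a g * b (g^-1 * h)%g.
Proof.
rewrite [a * b]/(ga_mul a b) /ga_mul /bilin_ext sum_ffunE.
apply: eq_bigr => g _.
rewrite sum_ffunE (bigD1 (g^-1 * h)%g) //= !ffunE mulKVg eqxx big1 ?addr0.
  exact: mulr1.
move=> k /negPf kh; rewrite !ffunE eq_sym (can2_eq (mulKg g) (mulKVg g)) kh.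
exact: mulr0.
Qed.

End GroupAlgebraFacts.

Lemma mxtrace_mul_sum (R : comPzRingType) n m (I : finType) (P : pred I)
    (A : 'M[R]_(n, m)) (c : I -> R) (f : I -> 'M_(m, n)) :
  \tr (A *m \sum_(i | P i) c i *: f i) = \sum_(i | P i) c i * \tr (A *m f i).
Proof.
rewrite mulmx_sumr raddf_sum; apply: eq_bigr => i _.
by rewrite -scalemxAr; exact: mxtraceZ.
Qed.

(** * The transport along the arrows of the groupoid *)

Section Groupoid.
Variables (C : numClosedFieldType) (gT hT qT : finGroupType).
Variables (E : extension gT hT qT) (s : ext_section E).
Variables (X : unitary_dual C (ext_sub E)) (T : intertwiners s X).
Local Notation G := (ext_sub E).
Local Notation j := (ext_proj E).
Local Notation act := (dual_act s X).

Section Transport.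
Variables (x y : X) (q : qT) (e : act x q = y).

(** R(x, h) = T_q rho_x(g)^-1 for h = g s(q) with g in G; here
    g^-1 = s(q) h^-1. *)
Definition transport (h : hT) : 'M[C]_(rep_dim y, rep_dim x) :=
  itw_to T e *m rep x (s q * h^-1)%g.

(** The inverse of R(x, h) on the fiber of j over q. *)
Definition transportV (h : hT) : 'M[C]_(rep_dim x, rep_dim y) :=
  rep x (h * (s q)^-1)%g *m (itw_to T e)^t*.

Lemma fiber_divl h : j h = q -> (s q * h^-1)%g \in G.
Proof. by move=> jh; rewrite mem_ext_sub ext_projM ext_projV secK jh mulgV. Qed.

Lemma fiber_divr h : j h = q -> (h * (s q)^-1)%g \in G.
Proof. by move=> jh; rewrite mem_ext_sub ext_projM ext_projV secK jh mulgV. Qed.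

Lemma transportVK h : j h = q -> transport h *m transportV h = 1%:M.
Proof.
move=> jh; rewrite mulmxA -(mulmxA (itw_to T e)).
rewrite -repr_mxM ?fiber_divl ?fiber_divr //.
by rewrite mulgA mulgKV mulgV repr_mx1 mulmx1 itw_toK.
Qed.

(** Both T T^* and T^* T are the identity; their traces are equal. *)
Lemma rep_dim_act : (rep_dim x)%:R = (rep_dim y)%:R :> C.
Proof.
by rewrite -!mxtrace1 -(itw_toVK T e) mxtrace_mulC itw_toK.
Qed.

End Transport.

(** The transport is a twisted representation of the groupoid, with the order of
    the factors reversed. *)
Lemma transportM x y z q1 q2 (e1 : act x q1 = y) (e2 : act y q2 = z)
    (e12 : act x (q1 * q2)%g = z) h1 h2 : j h1 = q1 -> j h2 = q2 ->
  transport e2 h2 *m transport e1 h1 =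
    cocycle T x q1 q2 *: transport e12 (h1 * h2)%g.
Proof.
move=> jh1 jh2; rewrite /transport mulmxA -(mulmxA (itw_to T e2)).
rewrite itw_to_conj ?fiber_divl // mulmxA (cocycle_itw_to T e1 e2 e12).
have [g1G g2G] := (fiber_divl jh1, ext_sub_conj (s q1) (fiber_divl jh2)).
rewrite -!scalemxAl -!mulmxA -repr_mxV ?tau_in //.
rewrite -(repr_mxM _ g2G g1G) -repr_mxM ?groupV ?tau_in //; last exact: groupM.
congr (_ *: (_ *m rep x _)).
by rewrite /tau !invMg !invgK !mulgA !mulgKV.
Qed.

(** The fiber of j over q is G s(q), so that sums over it are sums over G. *)
Lemma transport_orthogonality x x' y y' q (e : act x q = y) (e' : act x' q = y')
    (m : 'M[C]_(rep_dim x, rep_dim y)) :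
  \sum_(h | j h == q) \tr (m *m transport e h) *: transportV e' h =
  (\sum_(g in G) \tr (m *m itw_to T e *m rep x g^-1%g) *: rep x' g)
     *m (itw_to T e')^t*.
Proof.
rewrite mulmx_suml (reindex_inj (mulIg (s q))) /=.
apply: eq_big => [g|g gG].
  by rewrite mem_ext_sub ext_projM secK eq_mulgV1 mulgK.
by rewrite /transport /transportV mulgK invMg mulKVg scalemxAl mulmxA.
Qed.

Lemma transport_orthogonal x x' y y' q (e : act x q = y) (e' : act x' q = y')
    (m : 'M[C]_(rep_dim x, rep_dim y)) : x != x' ->
  \sum_(h | j h == q) \tr (m *m transport e h) *: transportV e' h = 0.
Proof.
move=> xx'; rewrite transport_orthogonality Schur_orthogonal ?mul0mx //;
  try exact: rep_irr.
by move=> /(@rep_inj _ _ _ X) /eqP; rewrite (negPf xx').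
Qed.

Lemma transport_dual x y q (e : act x q = y)
    (m : 'M[C]_(rep_dim x, rep_dim y)) :
  \sum_(h | j h == q) \tr (m *m transport e h) *: transportV e h =
  (#|G|%:R / (rep_dim x)%:R) *: m.
Proof.
rewrite transport_orthogonality Schur_orthogonality; last exact: rep_irr.
by rewrite -scalemxAl -mulmxA itw_toK mulmx1.
Qed.

(** * The inverse Fourier transform *)

(** The Plancherel weight of x. *)
Definition plancherel (x : X) : C := (rep_dim x)%:R / #|G|%:R.

Section InverseFourier.
Variables (x y : X) (q : qT) (e : act x q = y).

(** The element of the group algebra that corresponds to m (x, q), for m a
    linear map from V_y to V_x with y = q(x): the inverse Fourier transform. *)
Definition inv_fourier (m : 'M[C]_(rep_dim x, rep_dim y)) :
  group_algebra C hT :=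
  [ffun h => if j h == q
             then plancherel x * \tr (m *m transport e h) else 0].

Lemma inv_fourier_linear : linear inv_fourier.
Proof.
move=> c m m'; apply/ffunP=> h; rewrite !ffunE; case: ifP => _; last first.
  by rewrite [_ *: _]mulr0 addr0.
rewrite mulmxDl -scalemxAl linearP mulrDr; congr (_ + _).
exact: mulrCA.
Qed.
HB.instance Definition _ :=
  GRing.isLinear.Build C _ (group_algebra C hT) _ inv_fourier
    inv_fourier_linear.

End InverseFourier.

Lemma inv_fourier_eq x y q q' (e : act x q = y) (e' : act x q' = y) m :
  q = q' -> inv_fourier e m = inv_fourier e' m.
Proof.
by move=> qq'; case: q' / qq' e' => e'; rewrite (eq_irrelevance e e').
Qed.

Lemma plancherelK (x : X) :
  plancherel x * (#|G|%:R / (rep_dim x)%:R) = 1 :> C.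
Proof.
rewrite /plancherel mulrA mulfVK ?card_neq0 // mulfV //.
exact: irr_dim_neq0 (rep_irr x).
Qed.

(** The value at h of a product, expressed through the orthogonality sum by
    substituting R(h1^-1 h) = c R(h) R(h1)^-1 in the convolution. The object x'
    is the source of the arrow over q with target y'; it need not be x. *)
Lemma inv_fourier_mul_coef x y y' z q q' (e : act x q = y) (e' : act y' q' = z)
    x' (f : act x' q = y') (f' : act x' (q * q')%g = z) m m' h :
  j h = (q * q')%g ->
  (inv_fourier e m * inv_fourier e' m') h =
  cocycle T x' q q' * plancherel y' * plancherel x *
  \tr (m' *m transport f' h *m
         \sum_(h1 | j h1 == q) \tr (m *m transport e h1) *: transportV f h1).
Proof.
move=> jh; rewrite ga_mulE (bigID (fun h1 => j h1 == q)) /= [X in _ + X]big1.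
  rewrite addr0 mxtrace_mul_sum mulr_sumr; apply: eq_bigr => h1 /eqP jh1.
  have jh2 : j (h1^-1 * h)%g = q' by rewrite ext_projM ext_projV jh1 jh mulKg.
  have := transportM f e' f' jh1 jh2; rewrite mulKVg.
  move=> /(congr1 (fun A => A *m transportV f h1)).
  rewrite -mulmxA transportVK // mulmx1 -scalemxAl => E2.
  rewrite !ffunE jh1 jh2 !eqxx E2 -scalemxAr mxtraceZ (mulmxA m').
  by ring.
by move=> h1 /negPf jh1; rewrite !ffunE jh1 mul0r.
Qed.

Lemma inv_fourier_mul_support x y y' z q q' (e : act x q = y)
    (e' : act y' q' = z) m m' h :
  j h != (q * q')%g -> (inv_fourier e m * inv_fourier e' m') h = 0.
Proof.
move=> jh; rewrite ga_mulE big1 // => h1 _; rewrite !ffunE.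
case: eqP => [jh1|_]; last exact: mul0r.
case: eqP => [jh2|_]; last exact: mulr0.
by case/negP: jh; rewrite -jh1 -jh2 -ext_projM mulKVg.
Qed.

(** Composable arrows multiply with the cocycle, as in the twisted groupoid
    algebra, and their matrices multiply. *)
Lemma inv_fourierM x y z q q' (e : act x q = y) (e' : act y q' = z)
    (e'' : act x (q * q')%g = z) m m' :
  inv_fourier e m * inv_fourier e' m' =
    cocycle T x q q' *: inv_fourier e'' (m *m m').
Proof.
apply/ffunP=> h; have [jh|jh] := eqVneq (j h) (q * q')%g; last first.
  by rewrite inv_fourier_mul_support // !ffunE (negPf jh) [_ *: _]mulr0.
rewrite (inv_fourier_mul_coef e e' e e'') // transport_dual ffunE ffunE jh eqxx.
rewrite -scalemxAr mxtraceZ mxtrace_mulC (mulmxA m).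
have -> : plancherel y = plancherel x by rewrite /plancherel (rep_dim_act e).
have := plancherelK x; move: (#|G|%:R / _) => k pk.
set t := \tr _.
transitivity (cocycle T x q q' * (plancherel x * t) * (plancherel x * k)).
  by ring.
by rewrite pk mulr1.
Qed.

Lemma inv_fourierM0 x y y' z q q' (e : act x q = y) (e' : act y' q' = z) m m' :
  y != y' -> inv_fourier e m * inv_fourier e' m' = 0.
Proof.
move=> yy'; apply/ffunP=> h.
have [jh|jh] := eqVneq (j h) (q * q')%g; last first.
  by rewrite inv_fourier_mul_support // ffunE.
(* The source of the arrow over q with target y' differs from x. *)
pose x' := act y' q^-1%g; have f : act x' q = y' by rewrite -actM mulVg act1.
have f' : act x' (q * q')%g = z by rewrite actM f.
rewrite (inv_fourier_mul_coef e e' f f') // transport_orthogonal.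
  by rewrite mulmx0 mxtrace0 mulr0 ffunE.
by apply: contra yy' => /eqP xx'; rewrite -e -f xx'.
Qed.

(** Fourier inversion: the group elements are in the image of the inverse
    Fourier transform. *)
Lemma inv_fourier_complete q (y : X -> X) (e : forall x, act x q = y x) h :
  j h = q ->
  basis_vec C h = \sum_(x : X) inv_fourier (e x) (transportV (e x) h)
    :> group_algebra C hT.
Proof.
move=> jh; apply/ffunP=> h'; rewrite sum_ffunE ffunE.
have [jh'|jh'] := eqVneq (j h') q; last first.
  rewrite big1 => [|x _]; last by rewrite ffunE (negPf jh').
  by case: (eqVneq h' h) jh' => // ->; rewrite jh eqxx.
(* The coefficient of h' in the sum is the regular character at h h'^-1. *)
have hh'G : (h * h'^-1)%g \in G.
  by rewrite mem_ext_sub ext_projM ext_projV jh jh' mulgV.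
rewrite eq_sym eq_mulgV1 -(dual_regular_character X hh'G).
apply: eq_bigr => x _; rewrite ffunE jh' eqxx; congr (_ * \tr _).
rewrite mulmxA -(mulmxA (rep x _)) itw_toVK mulmx1.
by rewrite -repr_mxM ?fiber_divl ?fiber_divr // mulgA mulgKV.
Qed.

(** * The corner *)

(** The chosen basis vector of V_x; any choice would do. *)
Definition base_idx (x : X) : 'I_(rep_dim x) :=
  Ordinal (iffLR (mx_irrP _) (rep_irr x)).1.

(** E_xy, the elementary matrix at the chosen vectors of V_x and V_y. *)
Definition base_mx (x y : X) : 'M[C]_(rep_dim x, rep_dim y) :=
  delta_mx (base_idx x) (base_idx y).

Lemma base_mxM x y z : base_mx x y *m base_mx y z = base_mx x z.
Proof. exact: mul_delta_mx. Qed.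

Lemma base_mx_corner x y (m : 'M[C]_(rep_dim x, rep_dim y)) :
  base_mx x x *m m *m base_mx y y =
    m (base_idx x) (base_idx y) *: base_mx x y.
Proof.
pose col0 z : 'cV[C]_(rep_dim z) := delta_mx (base_idx z) 0.
pose row0 z : 'rV[C]_(rep_dim z) := delta_mx 0 (base_idx z).
have base_mxE z t : base_mx z t = col0 z *m row0 t by rewrite mul_delta_mx.
have entry : row0 x *m m *m col0 y = (m (base_idx x) (base_idx y))%:M.
  by rewrite -rowE -colE [LHS]mx11_scalar !mxE.
rewrite !base_mxE; transitivity (col0 x *m (row0 x *m m *m col0 y) *m row0 y).
  by rewrite !mulmxA.
by rewrite entry mul_mx_scalar -scalemxAl.
Qed.

Local Notation GA := (group_algebra C hT).
Local Notation TA := (twisted_algebra T).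

(** The image of the basis vector (x, q). *)
Definition corner_basis (u : X * qT) : GA :=
  inv_fourier (erefl (act u.1 u.2)) (base_mx _ _).

Lemma corner_basisE x y q (e : act x q = y) :
  corner_basis (x, q) = inv_fourier e (base_mx x y).
Proof. by case: y / e. Qed.

(** The embedding of the twisted groupoid algebra onto the corner eAe. *)
Definition corner (b : TA) : GA := \sum_u b u *: corner_basis u.

Lemma corner_linear : linear corner.
Proof.
move=> c b b'; rewrite /corner scaler_sumr -big_split; apply: eq_bigr => u _.
by rewrite !ffunE scalerDl scalerA.
Qed.
HB.instance Definition _ :=
  GRing.isLinear.Build C TA GA _ corner corner_linear.

Lemma corner_basis_vec u : corner (basis_vec C u) = corner_basis u.
Proof.
rewrite /corner (bigD1 u) //= big1 ?addr0 => [|v /negPf vu]; rewrite ffunE.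
  by rewrite eqxx scale1r.
by rewrite vu scale0r.
Qed.

Lemma cornerM : {morph corner : b b' / b * b'}.
Proof.
move=> b b'; move: b; apply: linear_basis_ext => [c b b2|c b b2|[x q]].
- by rewrite mulrDl -scalerAl linearP.
- by rewrite linearP mulrDl -scalerAl.
move: b'; apply: linear_basis_ext => [c b b2|c b b2|[y q']].
- by rewrite mulrDr -scalerAr linearP.
- by rewrite linearP mulrDr -scalerAr.
rewrite [_ * _ in LHS]bilin_ext_basis /tga_basis_mul /= !corner_basis_vec.
case: eqP => [->|/eqP yx].
  rewrite linearZ /= corner_basis_vec.
  have e : act x (q * q')%g = act (act x q) q' by rewrite actM.
  by rewrite (corner_basisE e) /corner_basis /= (inv_fourierM _ _ e) base_mxM.
by rewrite linear0 /corner_basis inv_fourierM0 // eq_sym.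
Qed.

Lemma corner1 : corner 1 = \sum_x inv_fourier (act1 act x) (base_mx x x).
Proof.
rewrite [1]/(tga_one T) /tga_one linear_sum; apply: eq_bigr => x _.
by rewrite /= corner_basis_vec (corner_basisE (act1 act x)).
Qed.

Lemma corner1_mull x y q (e : act x q = y) m :
  corner 1 * inv_fourier e m = inv_fourier e (base_mx x x *m m).
Proof.
rewrite corner1 mulr_suml (bigD1 x) //= big1 ?addr0 => [|z zx].
  have e' : act x (1 * q)%g = y by rewrite mul1g.
  rewrite (inv_fourierM _ _ e') cocycle1l scale1r.
  by rewrite (inv_fourier_eq _ e) // mul1g.
exact: inv_fourierM0.
Qed.

Lemma corner1_mulr x y q (e : act x q = y) m :
  inv_fourier e m * corner 1 = inv_fourier e (m *m base_mx y y).
Proof.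
rewrite corner1 mulr_sumr (bigD1 y) //= big1 ?addr0 => [|z zy].
  have e' : act x (q * 1)%g = y by rewrite mulg1.
  rewrite (inv_fourierM _ _ e') cocycle1r scale1r.
  by rewrite (inv_fourier_eq _ e) // mulg1.
by rewrite inv_fourierM0 // eq_sym.
Qed.

(** The corner is contained in the image: e h e is the sum of the (x, j(h))
    weighted by the coefficient of R(x, h)^-1 at the chosen vectors. *)
Lemma corner_surj a : exists b, corner b = corner 1 * a * corner 1.
Proof.
exists (\sum_h a h *: \sum_x
  transportV (erefl (act x (j h))) h (base_idx x) (base_idx _) *:
    basis_vec C (x, j h)).
(* The rules for products with e hold for every choice of arrows and matrices;
   with e abstracted, only they are used. *)
have e1l := corner1_mull; have e1r := corner1_mulr.
move: (corner 1) e1l e1r => e1 e1l e1r.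
rewrite (linear_sum corner) [a in RHS](basis_vec_sum a) mulr_sumr mulr_suml.
apply: eq_bigr => h _; rewrite linearZ (linear_sum corner).
rewrite (inv_fourier_complete (fun x => erefl (act x (j h))) (erefl (j h))).
rewrite -scalerAr -scalerAl mulr_sumr mulr_suml; congr (_ *: _).
apply: eq_bigr => x _; rewrite linearZ /= corner_basis_vec.
by rewrite e1l e1r base_mx_corner linearZ.
Qed.

Lemma inv_fourier_transport x x' y y' q (e : act x q = y) (e' : act x' q = y')
    (m : 'M[C]_(rep_dim x', rep_dim y')) :
  \sum_(h | j h == q) inv_fourier e' m h *: transportV e h =
  plancherel x' *:
    \sum_(h | j h == q) \tr (m *m transport e' h) *: transportV e h.
Proof.
rewrite scaler_sumr; apply: eq_bigr => h jh.
by rewrite ffunE jh scalerA.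
Qed.

(** The coefficient of b at (x, q) is recovered from the sum of
    corner(b)(h) R(x, h)^-1 over the fiber of q. *)
Lemma corner_inj : injective corner.
Proof.
apply: raddf_inj => b b0; apply/ffunP=> -[x q]; rewrite [RHS]ffunE.
pose e := erefl (act x q).
have : \sum_(h | j h == q) corner b h *: transportV e h = 0.
  by rewrite b0 big1 // => h _; rewrite ffunE scale0r.
under eq_bigr => h _ do rewrite sum_ffunE scaler_suml.
have term v : \sum_(h | j h == q) (b v *: corner_basis v) h *: transportV e h =
    b v *: \sum_(h | j h == q) corner_basis v h *: transportV e h.
  by rewrite scaler_sumr; apply: eq_bigr => h _; rewrite ffunE scalerA.
rewrite exchange_big (bigD1 (x, q)) //= [X in _ + X]big1 ?addr0.
  rewrite term (corner_basisE e) inv_fourier_transport transport_dual scalerA.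
  rewrite scalerA -mulrA plancherelK mulr1.
  by move=> /matrixP/(_ (base_idx x) (base_idx _)); rewrite !mxE !eqxx mulr1.
move=> [x' q'] nv; rewrite term; have [qq'|qq'] := eqVneq q' q.
  rewrite qq' xpair_eqE eqxx andbT in nv *.
  rewrite (corner_basisE (erefl _)) inv_fourier_transport.
  by rewrite transport_orthogonal ?scaler0.
rewrite big1 ?scaler0 // => h /eqP jh.
by rewrite ffunE jh eq_sym (negPf qq') scale0r.
Qed.

(** In each V_x the projections onto the basis vectors sum to the identity, and
    each of them factors through the projection E_xx onto the chosen one. *)
Lemma corner_full :
  \sum_(u : {x : X & 'I_(rep_dim x)})
     inv_fourier (act1 act (tag u)) (delta_mx (tagged u) (base_idx (tag u)))
       * corner 1 *
     inv_fourier (act1 act (tag u)) (delta_mx (base_idx (tag u)) (tagged u))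
    = 1.
Proof.
have j1 : j 1%g = 1%g by rewrite morph1.
rewrite [RHS](inv_fourier_complete (fun x => act1 act x) j1).
pose F x (i : 'I_(rep_dim x)) :=
  inv_fourier (act1 act x) (delta_mx i (base_idx x)) * corner 1 *
    inv_fourier (act1 act x) (delta_mx (base_idx x) i).
transitivity (\sum_x \sum_i F x i).
  by rewrite (sig_big_dep _ (fun _ => xpredT) F); apply: eq_bigr.
apply: eq_bigr => x _; rewrite /F.
under eq_bigr => i _.
  rewrite corner1_mulr.
  have e' : act x (1 * 1)%g = x by rewrite mulg1 act1.
  rewrite (inv_fourierM _ _ e') cocycle1l scale1r.
  rewrite (inv_fourier_eq _ (act1 act x)) ?mulg1 //.
  rewrite !mul_delta_mx; over.
rewrite -linear_sum; congr (inv_fourier _ _).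
rewrite /transportV itw_to1 sec1 invg1 mulg1 repr_mx1 mul1mx trmx1 map_mx1.
by rewrite mx1_sum_delta.
Qed.

Lemma twisted_algebra_morita : morita_equivalent GA TA.
Proof.
pose f : {linear TA -> GA} := corner.
apply: (@full_corner_morita C GA TA f _ _ _ _ _ _ corner_full).
- exact: cornerM.
- exact: corner_inj.
- exact: corner_surj.
Qed.

End Groupoid.

Theorem theorem1p1 (R : realType) (gT hT qT : finGroupType)
    (E : extension gT hT qT) (s : ext_section E)
    (X : unitary_dual R[i] (ext_sub E)) (T : intertwiners s X) :
  morita_equivalent (group_algebra R[i] hT) (twisted_algebra T).
Proof.
exact: twisted_algebra_morita.
Qed.
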